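(* In the Verstraete–Cirac (VC) encoding, the first-order ($p=1$) Trotter step $\mathcal P_1(t)=\prod_{\gamma}e^{-it\tilde H_\gamma}$ of the pionless-EFT Hamiltonian on an $L\times L\times L$ lattice can be implemented by a quantum circuit with 2-qubit gate depth at most $520$, and its controlled version $C[\mathcal P_1(t)]$ can be implemented with 2-qubit gate depth at most $630$ (independently of $L$ and $t$).
   Context: Circuit model: CNOT gates between arbitrary pairs of qubits and arbitrary one-qubit gates; the 2-qubit gate depth counts only layers of CNOT gates acting in parallel on disjoint qubits. $C[U]$ denotes $U$ controlled on an ancilla; separate ancilla qubits carrying the control are available for operations acting in parallel on different sites. Pionless EFT: four fermion species $\sigma\in\{\uparrow p,\downarrow p,\uparrow n,\downarrow n\}$ at each site of a cubic lattice with open boundary conditions, $H=-h\sum_{\langle\bm x,\bm y\rangle,\sigma}(a^\dagger_\sigma(\bm x)a_\sigma(\bm y)+\text{h.c.})+6h\sum_{\bm x,\sigma}N_\sigma(\bm x)+\frac C2\sum_{\bm x}\sum_{\sigma\ne\sigma'}N_\sigma N_{\sigma'}+\frac D6\sum_{\bm x}\sum_{\sigma,\sigma',\sigma''\text{ distinct}}N_\sigma N_{\sigma'}N_{\sigma''}$. VC encoding: sites are numbered $1,\dots,L^3$ along a snake (Jordan–Wigner) path running along rows in the $x$ direction, then through rows of an $x$–$y$ plane, then through planes along $z$. Each site has six qubits ordered $\uparrow p,\downarrow p,\uparrow n,\downarrow n,\mu,\nu$ (the last two auxiliary). With $S_j$ the product of the Pauli $Z$ operators on all six qubits of all sites $i<j$: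 $\tilde a_\sigma(j)=\frac12S_j\big(\prod_{\sigma'<\sigma}Z_j^{\sigma'}\big)(X_j^\sigma+iY_j^\sigma)$, and with $T_j=S_jZ_j^{\uparrow p}Z_j^{\downarrow p}Z_j^{\uparrow n}Z_j^{\downarrow n}$, $\tilde\mu(j)=T_jX_j^\mu$, $\bar{\tilde\mu}(j)=T_jY_j^\mu$, $\tilde\nu(j)=T_jZ_j^\mu X_j^\nu$, $\bar{\tilde\nu}(j)=T_jZ_j^\mu Y_j^\nu$. For neighbouring sites $i<j$ the hopping term $a_\sigma^\dagger(i)a_\sigma(j)+\text{h.c.}$ is encoded as $\tilde a^\dagger_\sigma(i)\tilde a_\sigma(j)+\text{h.c.}$ along $x$, as this operator times $i\tilde\mu(i)\bar{\tilde\mu}(j)$ along $y$, and as this operator times $i\tilde\nu(i)\bar{\tilde\nu}(j)$ along $z$. The number operator $N_\sigma(i)$ is encoded as $\frac12(1-Z_i^\sigma)$. Layers $\tilde H_\gamma$: six hopping layers (two site-disjoint sets of alternating bonds for each of the three directions, containing all four species), together with the layer of all on-site (number-operator and contact) terms. *)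

(* Defs.v *)
From HB Require Import structures.
From mathcomp Require Import all_boot all_order all_algebra.
From mathcomp Require Import complex.
From mathcomp Require Import boolp classical_sets reals topology normedtype.
From mathcomp Require Import sequences.

Set Implicit Arguments.
Unset Strict Implicit.
Unset Printing Implicit Defensive.

Import Order.TTheory GRing.Theory Num.Theory.
Import numFieldNormedType.Exports.

Local Open Scope ring_scope.
Local Open Scope sesquilinear_scope.

(* MathComp and MathComp-Analysis.  The complex numbers are R[i], viewed as a
   numClosedFieldType so that the topology of the norm is inferred for them. *)
Definition Cplx (R : realType) : numClosedFieldType := R[i].

(* Operators on the state space of the qubits Q: matrices indexed by the
   enumeration of the computational basis, a basis state being a map Q -> bool
   (false for |0>, true for |1>). *)
Notation basis Q := {ffun Q%type -> bool}.
Notation Op R Q := 'M[Cplx R]_#|basis Q|.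

Section Exponential.
Variables (R : realType) (n : nat).
Local Notation C := (Cplx R).

Definition expmx (A : 'M[C]_n) : 'M[C]_n :=
  \matrix_(i, j) limn (series (fun k => (k`!%:R)^-1 * (A ^+ k) i j : C)).

End Exponential.

Section Qubits.
Variables (R : realType) (Q : finType).
Local Notation C := (Cplx R).

Definition opmx (f : basis Q -> basis Q -> C) : Op R Q :=
  \matrix_(a, b) f (enum_val a) (enum_val b).

Definition entry (U : Op R Q) (a b : basis Q) : C :=
  U (enum_rank a) (enum_rank b).

(* The tensor product of the one-qubit operators u q. *)
Definition tensor (u : Q -> 'M[C]_2) : Op R Q :=
  opmx (fun a b => \prod_q u q (inord (a q)) (inord (b q))).

Definition single (q : Q) (u : 'M[C]_2) : Op R Q :=
  tensor (fun q' => if q' == q then u else 1%:M).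

Definition mx2 (a b c d : C) : 'M[C]_2 :=
  \matrix_(i, j) if i == 0 then (if j == 0 then a else b)
                 else (if j == 0 then c else d).

Definition pX (q : Q) : Op R Q := single q (mx2 0 1 1 0).
Definition pY (q : Q) : Op R Q := single q (mx2 0 (- 'i) 'i 0).
Definition pZ (q : Q) : Op R Q := single q (mx2 1 0 0 (-1)).

Definition cnot_fun (c t : Q) (b : basis Q) : basis Q :=
  [ffun q => if q == t then b t (+) b c else b q].

Definition cnot (c t : Q) : Op R Q :=
  opmx (fun a b => (a == cnot_fun c t b)%:R).

(* A circuit is a sequence of layers, the head being applied first.  A layer
   applies a one-qubit gate to every qubit (possibly the identity), or a set
   of CNOT gates, listed as pairs (control, target). *)
Inductive layer : Type :=
| OneQubit of (Q -> 'M[C]_2)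
| Cnots of seq (Q * Q).

Definition circuit : Type := seq layer.

Definition gate_qubits (s : seq (Q * Q)) : seq Q :=
  flatten [seq [:: g.1; g.2] | g <- s].

Definition valid_layer (l : layer) : Prop :=
  match l with
  | OneQubit u => forall q, u q \is unitarymx
  | Cnots s => uniq (gate_qubits s)
  end.

Fixpoint valid (c : circuit) : Prop :=
  if c is l :: c' then valid_layer l /\ valid c' else True.

Definition layer_op (l : layer) : Op R Q :=
  match l with
  | OneQubit u => tensor u
  | Cnots s => \prod_(g <- s) cnot g.1 g.2
  end.

Fixpoint circuit_op (c : circuit) : Op R Q :=
  if c is l :: c' then circuit_op c' * layer_op l else 1.

Definition two_qubit_depth (c : circuit) : nat :=
  count (fun l => if l is Cnots _ then true else false) c.

Definition implemented_with_depth (U : Op R Q) (d : nat) : Prop :=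
  exists c : circuit,
    [/\ valid c, (two_qubit_depth c <= d)%N & circuit_op c = U].

End Qubits.

Section Control.
Variables (R : realType) (A Q : finType).
Local Notation C := (Cplx R).

Definition target_bits (b : basis (option Q)) : basis Q := [ffun q => b (Some q)].

(* C[U] = |0><0| (x) 1 + |1><1| (x) U; the control qubit is None. *)
Definition controlled (U : Op R Q) : Op R (option Q) :=
  opmx (fun a b =>
    if a None != b None then 0
    else if b None then entry U (target_bits a) (target_bits b)
    else (target_bits a == target_bits b)%:R).

Definition copy_control (b : basis (option Q)) : basis (A + Q) :=
  [ffun x => match x with inl _ => b None | inr q => b (Some q) end].

(* The isometry |b>|psi> |-> |b...b>|psi>, with one copy of the control for
   each ancilla in A. *)
Definition spread_control : 'M[C]_(#|basis (A + Q)|, #|basis (option Q)|) :=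
  \matrix_(a, b) (enum_val a == copy_control (enum_val b))%:R.

(* C[U] is implemented by a circuit on the target qubits Q and the ancillas A,
   each of which carries the control. *)
Definition controlled_implemented_with_depth (U : Op R Q) (d : nat) : Prop :=
  exists c : circuit R (A + Q)%type,
    [/\ valid c, (two_qubit_depth c <= d)%N &
        circuit_op c *m spread_control = spread_control *m controlled U].

End Control.

Section Lattice.
Variable L : nat.

Definition site : finType := {ffun 'I_3 -> 'I_L}.

Definition ax_x : 'I_3 := @Ordinal 3 0 isT.
Definition ax_y : 'I_3 := @Ordinal 3 1 isT.
Definition ax_z : 'I_3 := @Ordinal 3 2 isT.

Definition mirror (b : bool) (k : nat) : nat := if b then (L.-1 - k)%N else k.

(* Position (from 0) along the path: odd rows are run through backwards, and so
   are the rows of odd planes. *)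
Definition snake (s : site) : nat :=
  let row := (s ax_z * L + mirror (odd (s ax_z)) (s ax_y))%N in
  (row * L + mirror (odd row) (s ax_x))%N.

Definition next_along (d : 'I_3) (s s' : site) : bool :=
  (s' d == (s d).+1 :> nat) && [forall e, (e != d) ==> (s e == s' e)].

(* Bonds in direction d, each counted once by ordering its ends along the
   path. *)
Definition bond (d : 'I_3) (i j : site) : bool :=
  (next_along d i j || next_along d j i) && (snake i < snake j)%N.

Definition bond_parity (d : 'I_3) (i j : site) : bool := odd (minn (i d) (j d)).

End Lattice.

Section VC.
Variables (R : realType) (L : nat).
Local Notation C := (Cplx R).

(* The six qubits of a site: 0, 1, 2, 3 for the species up-p, down-p, up-n,
   down-n, then 4 for mu and 5 for nu. *)
Definition vc_qubit : finType := (site L * 'I_6)%type.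
Local Notation op := (Op R vc_qubit).

Definition fermion (s : 'I_4) : 'I_6 := widen_ord (isT : (4 <= 6)%N) s.
Definition mu : 'I_6 := @Ordinal 6 4 isT.
Definition nu : 'I_6 := @Ordinal 6 5 isT.

Definition vcX (j : site L) (q : 'I_6) : op := pX R ((j, q) : vc_qubit).
Definition vcY (j : site L) (q : 'I_6) : op := pY R ((j, q) : vc_qubit).
Definition vcZ (j : site L) (q : 'I_6) : op := pZ R ((j, q) : vc_qubit).

Definition vc_S (j : site L) : op :=
  \prod_(i : site L | (snake i < snake j)%N) \prod_(q : 'I_6) vcZ i q.

Definition vc_a (s : 'I_4) (j : site L) : op :=
  2^-1 *: (vc_S j * (\prod_(s' : 'I_4 | (s' < s)%N) vcZ j (fermion s'))
           * (vcX j (fermion s) + 'i *: vcY j (fermion s))).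

Definition vc_T (j : site L) : op :=
  vc_S j * \prod_(s : 'I_4) vcZ j (fermion s).

Definition vc_mu (j : site L) : op := vc_T j * vcX j mu.
Definition vc_mubar (j : site L) : op := vc_T j * vcY j mu.
Definition vc_nu (j : site L) : op := vc_T j * vcZ j mu * vcX j nu.
Definition vc_nubar (j : site L) : op := vc_T j * vcZ j mu * vcY j nu.

Definition vc_N (s : 'I_4) (j : site L) : op :=
  2^-1 *: (1 - vcZ j (fermion s)).

Definition vc_jw_hop (s : 'I_4) (i j : site L) : op :=
  let A : op := (vc_a s i)^t* * vc_a s j in A + A^t*.

Definition vc_hop (d : 'I_3) (s : 'I_4) (i j : site L) : op :=
  if d == ax_x then vc_jw_hop s i j
  else if d == ax_y then vc_jw_hop s i j * ('i *: (vc_mu i * vc_mubar j))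
  else vc_jw_hop s i j * ('i *: (vc_nu i * vc_nubar j)).

Definition real_op (r : R) (A : op) : op := (r%:C%C : C) *: A.

(* The couplings C and D of the two- and three-body contact terms are cC and dD. *)
Variables (h cC dD : R).

Definition vc_hop_layer (d : 'I_3) (p : bool) : op :=
  real_op (- h) (\sum_(b : site L * site L |
                     bond d b.1 b.2 && (bond_parity d b.1 b.2 == p))
                   \sum_(s : 'I_4) vc_hop d s b.1 b.2).

Definition vc_onsite : op :=
  real_op (6 * h) (\sum_(x : site L) \sum_(s : 'I_4) vc_N s x)
  + real_op (cC / 2) (\sum_(x : site L) \sum_(s : 'I_4)
      \sum_(s' : 'I_4 | s' != s) vc_N s x * vc_N s' x)
  + real_op (dD / 6) (\sum_(x : site L) \sum_(s : 'I_4)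
      \sum_(s' : 'I_4 | s' != s) \sum_(s'' : 'I_4 | (s'' != s) && (s'' != s'))
        vc_N s x * vc_N s' x * vc_N s'' x).

(* Some (d, p): the bonds in direction d whose lower end has coordinate of
   parity p along d;  None: the on-site terms. *)
Definition layer_index : finType := option ('I_3 * bool)%type.

Definition vc_layer (g : layer_index) : op :=
  if g is Some dp then vc_hop_layer dp.1 dp.2 else vc_onsite.

Definition trotter1 (order : seq layer_index) (t : R) : op :=
  \prod_(g <- order) expmx (- 'i *: real_op t (vc_layer g)).

Definition vc_hamiltonian : op :=
  real_op (- h) (\sum_(d : 'I_3) \sum_(b : site L * site L | bond d b.1 b.2)
                   \sum_(s : 'I_4) vc_hop d s b.1 b.2) + vc_onsite.

Lemma vc_hamiltonian_layers :
  vc_hamiltonian = \sum_(g : layer_index) vc_layer g.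
Proof.
rewrite (bigD1 None) //= addrC; congr (_ + _).
rewrite /real_op scaler_sumr.
rewrite (reindex_omap Some id) /=; last by case.
rewrite [RHS](eq_bigl predT); last by move=> x; rewrite eqxx.
rewrite -(pair_bigA _ (fun d p => vc_hop_layer d p)) /=.
apply: eq_bigr => d _.
rewrite big_bool [RHS]/= /vc_hop_layer /real_op -scalerDr; congr (_ *: _).
rewrite (bigID (fun b : site L * site L => bond_parity d b.1 b.2)) /=.
by congr (_ + _); apply: eq_bigl => b; rewrite ?eqb_id ?eqbF_neg.
Qed.

End VC.

(* Main.v *)
Require Import Defs.
From mathcomp Require Import all_boot all_order all_algebra.
From mathcomp Require Import ring zify.
From mathcomp Require Import complex.
From mathcomp Require Import boolp classical_sets reals topology normedtype.
From mathcomp Require Import sequences exp trigo.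

(* The exponential of a layer is a product of exponentials of commuting sums of
   Pauli strings with equal coefficients, one sum over all the bonds of the
   layer for each species and each of the two strings of a hopping term.  After
   a layer of one-qubit Clifford gates such a sum is diagonal, of the form
   c * sum_b (-1)^(parity of bits at the bond b), and a parity is brought onto
   one qubit by layers of CNOT gates acting on all bonds at once; what remains
   is a layer of one-qubit phases.  The on-site layer is a sum of 14 parities.
   This costs 476 CNOT layers.  Only the 62 layers of one-qubit phases have to
   be controlled, and two CNOT layers from the ancillas do that, since
   x (1 - 2 y) is a combination of the parities x, y and x + y: hence 600. *)

Set Implicit Arguments.
Unset Strict Implicit.
Unset Printing Implicit Defensive.

Import Defs Order.TTheory GRing.Theory Num.Theory.
Import numFieldNormedType.Exports.

Local Open Scope ring_scope.
Local Open Scope sesquilinear_scope.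

(** * Exponentials of commuting Hermitian matrices *)

(** The depth can be independent of [L] only because the Jordan-Wigner tails cancel. Along x the
    ends of a bond are consecutive on the snake path; along y and z the auxiliary pair carries the
    same Z on the sites in between as the hopping term. Each hopping term thus becomes two Pauli
    strings supported on the two sites of its bond. Bonds of one layer share no site, and the
    coefficients depend only on the direction and the kind of string, so one change of basis and one
    sequence of CNOT layers serve all bonds at once. Control is cheap because conjugating gates
    cancel around the identity: they can stay uncontrolled. The plain and the controlled circuit
    therefore obey the same accounting rules and differ only in the price [f0] of a layer of phases,
    0 or 2. One computation, 476 + 62 [f0], gives both bounds. *)

Section Expi.
Variable R : realType.
Local Notation C := (Cplx R).

Definition expi (r : R) : C := (cos r +i* sin r)%C.

Lemma expi0 : expi 0 = 1.
Proof. by rewrite /expi cos0 sin0. Qed.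

Lemma expiD r r' : expi (r + r') = expi r * expi r'.
Proof.
rewrite /expi cosD sinD; apply/eqP; rewrite eq_complex /= eqxx /=.
by rewrite addrC.
Qed.

Lemma expi_sum (I : Type) (s : seq I) (P : pred I) (F : I -> R) :
  expi (\sum_(i <- s | P i) F i) = \prod_(i <- s | P i) expi (F i).
Proof. exact: (big_morph expi expiD expi0). Qed.

Lemma conj_expi r : (expi r)^* = expi (- r).
Proof. by rewrite /expi cosN sinN. Qed.

Lemma conj_real_complex (r : R) : (r%:C%C : C)^* = r%:C%C.
Proof. exact: conjc_real. Qed.

Lemma trmxC_mul m n p (A : 'M[C]_(m, n)) (B : 'M[C]_(n, p)) :
  (A *m B)^t* = B^t* *m A^t*.
Proof. by rewrite trmx_mul map_mxM. Qed.

Lemma cvg_real_complex (u : nat -> R) (l : R) :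
  (u @ \oo --> l)%classic ->
  ((fun n => (u n)%:C%C : C) @ \oo --> (l%:C%C : C))%classic.
Proof.
move=> ul; apply/cvgrPdist_lt => e e0.
have eR : e = ((complex.Re e)%:C%C : C) by rewrite RRe_real// gtr0_real.
have e0' : 0 < complex.Re e by rewrite -ltcR -eR.
move/cvgrPdist_lt : ul => /(_ _ e0'); apply: filterS => n.
rewrite -rmorphB {2}eR normc_def /= expr0n addr0 sqrtr_sqr ltcR //.
Qed.

Lemma cvg_expi (r : R) :
  (series (fun k => (k`!%:R)^-1 * ('i * (r%:C%C : C)) ^+ k : C) @ \oo
   --> expi r)%classic.
Proof.
have hs := @is_cvg_series_sin_coeff R r; have hc := @is_cvg_series_cos_coeff R r.
have -> : expi r = (cos r)%:C%C + 'i * ((sin r)%:C%C : C).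
  rewrite /expi; apply/eqP; rewrite eq_complex /=.
  by rewrite !(mul0r, mul1r, mulr0, subr0, addr0, add0r) !eqxx.
have -> : series (fun k => (k`!%:R)^-1 * ('i * (r%:C%C : C)) ^+ k : C) =
   (fun n => (series (cos_coeff r) n)%:C%C + 'i * ((series (sin_coeff r) n)%:C%C : C)).
  apply/funext => n; rewrite /series /= !rmorph_sum mulr_sumr -big_split /=.
  apply: eq_bigr => k _.
  rewrite /cos_coeff /sin_coeff /= exprMn.
  (* Splitting the powers of ['i] by parity turns the k-th term into the k-th cosine coefficient
     plus ['i] times the k-th sine coefficient. *)
  have -> : ('i : C) ^+ k = ((~~ odd k)%:R * (-1) ^+ k./2)
      + 'i * ((odd k)%:R * (-1) ^+ k.-1./2).
    rewrite -{1}(odd_double_half k); case: (boolP (odd k)) => ok /=.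
      rewrite add1n exprS -mul2n exprM sqrCi mul0r add0r mul1r.
      by rewrite -{2}(odd_double_half k) ok add1n /= doubleK.
    by rewrite add0n -mul2n exprM sqrCi mul0r mulr0 addr0 mul1r.
  rewrite !rmorphM /= !fmorphV !rmorph_nat !rmorphXn /= !rmorphN !rmorph1.
  set a := (-1) ^+ _; set b := (-1) ^+ k.-1./2.
  ring.
apply: cvgD; first by apply: cvg_real_complex; rewrite unlock.
apply: cvgM; first exact: cvg_cst.
by apply: cvg_real_complex; rewrite unlock.
Qed.

Lemma cvg_sumC (I : Type) (r : seq I) (u : I -> nat -> C) (l : I -> C) :
  (forall i, (u i @ \oo --> l i)%classic) ->
  ((fun n => \sum_(i <- r) u i n) @ \oo --> \sum_(i <- r) l i)%classic.
Proof.
move=> ul; elim: r => [|i r IH].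
  rewrite big_nil [X in (X @ _)%classic](_ : _ = fun=> 0); first exact: cvg_cst.
  by apply/funext => n; rewrite big_nil.
rewrite big_cons [X in (X @ _)%classic](_ : _ = fun n => u i n + \sum_(j <- r) u j n).
  exact: (cvgD (ul i) IH).
by apply/funext => n; rewrite big_cons.
Qed.

End Expi.

Section Expmx.
Variables (R : realType) (n : nat).
Local Notation C := (Cplx R).
Implicit Types (A B P : 'M[C]_n) (d : 'I_n -> R).

Definition unitary_diag P d : 'M[C]_n :=
  P^t* *m diag_mx (\row_j ((d j)%:C%C : C)) *m P.

Definition expmx_mi A : 'M[C]_n := expmx (- 'i *: A).

(** [expmx] is an entrywise limit. Powers are diagonal in the basis [P], so each entry is a fixed
    finite combination of the scalar series of [cvg_expi]. *)
Lemma exp_unitary_diag P d : P \is unitarymx ->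
  expmx_mi (unitary_diag P d) =
  P^t* *m diag_mx (\row_j expi (- d j)) *m P.
Proof.
move=> PU; have PP : P *m P^t* = 1%:M by apply/unitarymxP.
rewrite /expmx_mi.
have powE k : (- 'i *: unitary_diag P d) ^+ k =
   P^t* *m diag_mx (\row_j ('i * ((- d j)%:C%C : C)) ^+ k) *m P.
  elim: k => [|k IH].
    rewrite expr0; transitivity (P^t* *m P).
      rewrite -invmx_unitary // mulVmx //; exact: unitarymx_unit.
    congr (_ *m _); rewrite -[LHS]mulmx1; congr (_ *m _).
    by apply/matrixP => i j; rewrite !mxE expr0.
  rewrite exprS IH -[LHS]/((- 'i *: unitary_diag P d) *m _).
  rewrite /unitary_diag scalemxAl scalemxAr !mulmxA -(mulmxA _ P) PP mulmx1.
  rewrite -(mulmxA (P^t*) (- 'i *: _)); congr (_ *m _ *m _).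
  rewrite -scalemxAl mulmx_diag -linearZ; congr diag_mx.
  by apply/rowP => j; rewrite !mxE exprS rmorphN mulrN mulrA !mulNr.
apply/matrixP => i j; rewrite mxE.
apply: cvg_lim; first exact: norm_hausdorff.
have -> : series (fun k => (k`!%:R)^-1 * ((- 'i *: unitary_diag P d) ^+ k) i j : C)
   = (fun m => \sum_l (P^t* i l * P l j) *
         series (fun k => (k`!%:R)^-1 * ('i * ((- d l)%:C%C : C)) ^+ k : C) m).
  apply/funext => m; rewrite /series /=.
  under [RHS]eq_bigr do rewrite mulr_sumr.
  rewrite exchange_big /=; apply: eq_bigr => k _.
  rewrite powE mxE mulr_sumr; apply: eq_bigr => l _.
  rewrite mul_mx_diag !mxE; ring.
rewrite mxE.
rewrite [X in (_ --> X)%classic](_ : _ = \sum_l (P^t* i l * P l j) * expi (- d l)); last first.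
  by apply: eq_bigr => l _; rewrite mul_mx_diag !mxE mulrAC.
apply: cvg_sumC => l; apply: cvgM; [exact: cvg_cst|exact: cvg_expi].
Qed.

Lemma herm_trig_diag (T : 'M[C]_n) : T^t* = T -> is_trig_mx T ->
  T = diag_mx (\row_j ((complex.Re (T j j))%:C%C : C)).
Proof.
move=> hT /is_trig_mxP lo; apply/matrixP => i j; rewrite [RHS]mxE [in RHS]mxE.
have [<-|ij] := eqVneq i j.
  rewrite mulr1n; apply/esym; apply: RRe_real.
  by apply/CrealP; rewrite -{2}hT mxE mxE.
rewrite mulr0n.
case: (ltngtP i j) => [/lo //|ji|/val_inj/eqP]; last by rewrite (negPf ij).
by rewrite -hT mxE mxE lo // rmorph0.
Qed.

(** Commuting matrices have a common unitary trigonalization, and a Hermitian triangular matrix is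
    diagonal with real entries. *)
Lemma codiag A B : A^t* = A -> B^t* = B -> A *m B = B *m A ->
  exists P dA dB, [/\ P \is unitarymx, A = unitary_diag P dA & B = unitary_diag P dB].
Proof.
move=> hA hB AB; have [n0|n0] := posnP n.
  exists 1%:M, (fun=> 0), (fun=> 0); split; first by apply/unitarymxP/matrixP => i; have := ltn_ord i; rewrite {2}n0.
  1,2: by apply/matrixP => i; have := ltn_ord i; rewrite {2}n0.
have [P PU] := cotrigonalization2 AB.
move=> /andP[tA tB].
have PP : P *m P^t* = 1%:M by apply/unitarymxP.
have PP' : P^t* *m P = 1%:M by exact: mulmx1C.
have diagP M : M^t* = M -> similar_trig P M -> exists d, M = unitary_diag P d.
  move=> hM; rewrite /similar_to conjymx // => trM.
  set T := P *m M *m P^t* in trM.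
  have hT : T^t* = T by rewrite /T !trmxC_mul trmxCK hM mulmxA.
  exists (fun j => complex.Re (T j j)).
  have TE := herm_trig_diag hT trM.
  by rewrite /unitary_diag -TE /T !mulmxA PP' mul1mx -mulmxA PP' mulmx1.
have [dA ->] := diagP _ hA tA; have [dB ->] := diagP _ hB tB.
by exists P, dA, dB.
Qed.

(** In a common eigenbasis this reduces to [expiD] for each pair of eigenvalues; no product of
    matrix series has to be expanded. *)
Lemma expmx_miD A B : A^t* = A -> B^t* = B -> A *m B = B *m A ->
  expmx_mi (A + B) = expmx_mi A *m expmx_mi B.
Proof.
move=> hA hB /(codiag hA hB) [P [dA [dB [PU -> ->]]]].
have PP : P *m P^t* = 1%:M by apply/unitarymxP.
have -> : unitary_diag P dA + unitary_diag P dB = unitary_diag P (fun j => dA j + dB j).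
  rewrite /unitary_diag -mulmxDl -mulmxDr; congr (_ *m _ *m _).
  rewrite -linearD; congr diag_mx; apply/rowP => j; rewrite !mxE.
  by rewrite rmorphD.
rewrite !exp_unitary_diag // !mulmxA -(mulmxA _ P) PP mulmx1.
rewrite -(mulmxA _ (diag_mx _) (diag_mx _)) mulmx_diag; congr (_ *m diag_mx _ *m _).
by apply/rowP => j; rewrite !mxE opprD expiD.
Qed.

End Expmx.

(** * Operators on qubits *)

Section Operators.
Variables (R : realType) (Q : finType).
Local Notation C := (Cplx R).
Implicit Types (U V : Op R Q) (a b c : basis Q) (u v : Q -> 'M[C]_2).

Lemma entry_opmx (f : basis Q -> basis Q -> C) a b : entry (opmx f) a b = f a b.
Proof. by rewrite /entry mxE !enum_rankK. Qed.

Lemma entryP U V : (forall a b, entry U a b = entry V a b) -> U = V.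
Proof.
move=> UV; apply/matrixP => i j.
by have := UV (enum_val i) (enum_val j); rewrite /entry !enum_valK.
Qed.

Lemma entryM U V a b : entry (U * V) a b = \sum_c entry U a c * entry V c b.
Proof.
rewrite {1}/entry mxE (reindex (@enum_rank (basis Q))) /=.
  exact: eq_bigr.
by exists enum_val => x _; rewrite ?enum_rankK ?enum_valK.
Qed.

Lemma entry1 a b : entry (1 : Op R Q) a b = (a == b)%:R.
Proof. by rewrite /entry mxE (inj_eq enum_rank_inj). Qed.

Lemma entryD U V a b : entry (U + V) a b = entry U a b + entry V a b.
Proof. by rewrite /entry mxE. Qed.

Lemma entryZ (x : C) U a b : entry (x *: U) a b = x * entry U a b.
Proof. by rewrite /entry mxE. Qed.

Lemma entry_trmxC U a b : entry (U^t*) a b = (entry U b a)^*.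
Proof. by rewrite /entry !mxE. Qed.

Lemma entry_sum (I : Type) (r : seq I) (P : pred I) (F : I -> Op R Q) a b :
  entry (\sum_(i <- r | P i) F i) a b = \sum_(i <- r | P i) entry (F i) a b.
Proof. by rewrite /entry summxE. Qed.

Lemma sum_bool_ord (F : 'I_2 -> C) : \sum_(x : bool) F (inord x) = \sum_i F i.
Proof.
rewrite big_bool big_ord_recl big_ord1 addrC; congr (F _ + F _).
  by apply: val_inj; rewrite /= inordK.
by apply: val_inj; rewrite /= inordK.
Qed.

Lemma entry_tensor u a b :
  entry (tensor u) a b = \prod_q u q (inord (a q)) (inord (b q)).
Proof. exact: entry_opmx. Qed.

Lemma tensorM u v : tensor u * tensor v = tensor (fun q => u q * v q).
Proof.
apply: entryP => a b; rewrite entryM entry_tensor.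
under [LHS]eq_bigr do rewrite !entry_tensor -big_split /=.
(* A sum over basis states of a product over qubits is a product over qubits of sums over one
   bit. *)
rewrite -(bigA_distr_bigA (fun q (x : bool) => u q (inord (a q)) (inord x) * v q (inord x) (inord (b q)))).
apply: eq_bigr => q _.
by rewrite (sum_bool_ord (fun i => u q (inord (a q)) i * v q i (inord (b q)))) mxE.
Qed.

Lemma tensor1 : tensor (fun=> 1) = 1 :> Op R Q.
Proof.
apply: entryP => a b; rewrite entry_tensor entry1.
have [->|/eqP ab] := eqVneq a b; first by rewrite big1 // => q _; rewrite mxE eqxx.
have [q qab] : exists q, a q != b q.
  apply/existsP; rewrite -negb_forall; apply/negP => /forallP /= h.
  by apply: ab; apply/ffunP => q; apply/eqP.
rewrite (bigD1 q) //= mxE; suff -> : (inord (a q) == inord (b q) :> 'I_2) = false by rewrite mul0r.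
apply/negbTE; apply: contra qab => /eqP/(congr1 val) /=.
by rewrite !inordK ?ltnS ?leq_b1 //; case: (a q); case: (b q).
Qed.

Lemma tensor_trmxC u : (tensor u)^t* = tensor (fun q => (u q)^t*).
Proof.
apply: entryP => a b; rewrite entry_trmxC !entry_tensor rmorph_prod.
by apply: eq_bigr => q _; rewrite !mxE.
Qed.

Lemma eq_tensor u v : u =1 v -> tensor u = tensor v.
Proof.
by move=> uv; apply: entryP => a b; rewrite !entry_tensor; apply: eq_bigr => q _; rewrite uv.
Qed.

Lemma tensorZ (x : Q -> C) u : tensor (fun q => x q *: u q) = (\prod_q x q) *: tensor u.
Proof.
apply: entryP => a b; rewrite entryZ !entry_tensor -big_split /=.
by apply: eq_bigr => q _; rewrite mxE.
Qed.

Lemma tensor_prod (I : Type) (r : seq I) (P : pred I) (F : I -> Q -> 'M[C]_2) :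
  \prod_(i <- r | P i) tensor (F i) = tensor (fun q => \prod_(i <- r | P i) F i q).
Proof.
elim: r => [|i r IH].
  by rewrite big_nil -tensor1; apply: eq_tensor => q; rewrite big_nil.
rewrite big_cons IH; case: ifP => Pi.
  by rewrite tensorM; apply: eq_tensor => q; rewrite big_cons Pi.
by apply: eq_tensor => q; rewrite big_cons Pi.
Qed.

Lemma tensor_unitary u : (forall q, u q \is unitarymx) -> tensor u \is unitarymx.
Proof.
move=> uU; apply/unitarymxP; rewrite tensor_trmxC -[LHS]/(_ * _) tensorM -[RHS]tensor1.
by apply: eq_tensor => q; apply/unitarymxP.
Qed.

Definition diagop (phi : basis Q -> C) : Op R Q :=
  opmx (fun a b => if a == b then phi a else 0).

Lemma entry_diagop phi a b :
  entry (diagop phi) a b = if a == b then phi a else 0.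
Proof. exact: entry_opmx. Qed.

Lemma eq_diagop phi psi : phi =1 psi -> diagop phi = diagop psi.
Proof. by move=> e; apply: entryP => a b; rewrite !entry_diagop e. Qed.

Lemma diagop1 : diagop (fun=> 1) = 1.
Proof. by apply: entryP => a b; rewrite entry_diagop entry1; case: eqP. Qed.

Lemma entry_diagopM phi U a b : entry (diagop phi * U) a b = phi a * entry U a b.
Proof.
rewrite entryM (bigD1 a) //= entry_diagop eqxx big1 ?addr0 // => c ca.
by rewrite entry_diagop eq_sym (negPf ca) mul0r.
Qed.

Lemma entry_Mdiagop phi U a b : entry (U * diagop phi) a b = entry U a b * phi b.
Proof.
rewrite entryM (bigD1 b) //= entry_diagop eqxx big1 ?addr0 // => c ca.
by rewrite entry_diagop (negPf ca) mulr0.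
Qed.

Lemma diagopM phi psi : diagop phi * diagop psi = diagop (fun b => phi b * psi b).
Proof.
apply: entryP => a b; rewrite entry_diagopM !entry_diagop.
by case: eqP => _; rewrite ?mulr0.
Qed.

Lemma diagopD phi psi : diagop phi + diagop psi = diagop (fun b => phi b + psi b).
Proof.
apply: entryP => a b; rewrite entryD !entry_diagop.
by case: eqP => _; rewrite ?addr0.
Qed.

Lemma diagopZ x phi : x *: diagop phi = diagop (fun b => x * phi b).
Proof.
apply: entryP => a b; rewrite entryZ !entry_diagop.
by case: eqP => _; rewrite ?mulr0.
Qed.

Lemma diagop_sum (I : Type) (r : seq I) (P : pred I) (F : I -> basis Q -> C) :
  \sum_(i <- r | P i) diagop (F i) = diagop (fun b => \sum_(i <- r | P i) F i b).
Proof.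
apply: entryP => a b; rewrite entry_sum entry_diagop.
under eq_bigr do rewrite entry_diagop.
by case: eqP => _ //; rewrite big1.
Qed.

Definition diag2 (f : bool -> C) : 'M[C]_2 := mx2 (f false) 0 0 (f true).

Lemma diag2E f (x y : bool) : diag2 f (inord x) (inord y) = if x == y then f x else 0.
Proof.
by rewrite /diag2 /mx2 mxE -!val_eqE /= !inordK ?ltnS ?leq_b1 //; case: x; case: y.
Qed.

Lemma tensor_diag2 (f : Q -> bool -> C) :
  tensor (fun q => diag2 (f q)) = diagop (fun b => \prod_q f q (b q)).
Proof.
apply: entryP => a b; rewrite entry_tensor entry_diagop.
under eq_bigr do rewrite diag2E.
have [->|/eqP ab] := eqVneq a b; first by apply: eq_bigr => q _; rewrite eqxx.
have [q qab] : exists q, a q != b q.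
  apply/existsP; rewrite -negb_forall; apply/negP => /forallP /= h.
  by apply: ab; apply/ffunP => q; apply/eqP.
by rewrite (bigD1 q) //= (negPf qab) mul0r.
Qed.

(** The rightmost factor of the product of gates acts first, hence [foldr]. *)
Definition cnots_fun (s : seq (Q * Q)) (b : basis Q) : basis Q :=
  foldr (fun g => cnot_fun g.1 g.2) b s.

Lemma entry_cnots s a b :
  entry (\prod_(g <- s) cnot R g.1 g.2) a b = (a == cnots_fun s b)%:R.
Proof.
elim: s a => [|g s IH] a; first by rewrite big_nil entry1.
rewrite big_cons entryM (bigD1 (cnots_fun s b)) //= [X in _ + X]big1 => [|c cs]; last first.
  by rewrite IH (negPf cs) mulr0.
by rewrite IH eqxx mulr1 addr0 entry_opmx.
Qed.

(** A gate that permutes the basis by an involution only relabels the diagonal. This is how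
    conjugation by CNOT gates turns a phase depending on single bits into one depending on
    parities. *)
Lemma conj_diagop (F : basis Q -> basis Q) (G : Op R Q) phi :
  involutive F -> (forall a b, entry G a b = (a == F b)%:R) ->
  G * diagop phi * G = diagop (phi \o F).
Proof.
move=> FF GE; apply: entryP => a b; rewrite entryM entry_diagop.
under eq_bigr do rewrite entry_Mdiagop !GE.
rewrite (bigD1 (F b)) //= eqxx mulr1 big1 => [|c /negPf ->]; last by rewrite mulr0.
rewrite FF addr0; case: eqP => [->|_]; by rewrite ?mul1r ?mul0r.
Qed.

Lemma conj_cnots_invol (F : basis Q -> basis Q) (G : Op R Q) :
  involutive F -> (forall a b, entry G a b = (a == F b)%:R) -> G * G = 1.
Proof.
move=> FF GE; have := conj_diagop (fun=> 1) FF GE.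
by rewrite diagop1 mulr1 => ->; rewrite -diagop1; apply: eq_diagop.
Qed.

Lemma uniq_gate_qubits (s : seq (Q * Q)) :
  uniq (gate_qubits s) = uniq ([seq g.1 | g <- s] ++ [seq g.2 | g <- s]).
Proof.
apply: perm_uniq; elim: s => //= g s IH.
rewrite /gate_qubits /= perm_cons perm_sym.
rewrite -cat1s perm_catCA /= perm_cons perm_sym; exact: IH.
Qed.

(** On disjoint pairs no target is the control of another gate, so every gate reads the original
    bits and the order of the list is irrelevant. *)
Lemma cnots_funE s b q : uniq (gate_qubits s) ->
  cnots_fun s b q = b q (+) \big[addb/false]_(g <- s | g.2 == q) b g.1.
Proof.
elim: s q => [|g s IH] q; first by rewrite big_nil addbF.
rewrite /gate_qubits /= inE negb_or => /and3P[/andP[g12 g1] g2 us].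
rewrite ffunE big_cons /= -/(cnots_fun s b) eq_sym.
have nosum x : x \notin gate_qubits s -> \big[addb/false]_(h <- s | h.2 == x) b h.1 = false.
  move=> xs; rewrite big_seq_cond big_pred0 // => h.
  apply/andP => -[hs /eqP hx]; move/negP: xs; apply.
  by rewrite -hx; apply/flatten_mapP; exists h => //; rewrite !inE eqxx orbT.
case: eqP => [<-|_]; last by rewrite IH.
by rewrite !IH // !nosum // !addbF.
Qed.

Lemma cnots_fun_invol s : uniq (gate_qubits s) -> involutive (cnots_fun s).
Proof.
move=> us b; apply/ffunP => q; rewrite !cnots_funE // -addbA -big_split /=.
rewrite big_seq_cond big1 ?addbF // => g /andP[gs _].
rewrite cnots_funE //= big_seq_cond big_pred0 ?addbF ?addbb // => h.
apply/andP => -[hs /eqP hg]; move: us; rewrite uniq_gate_qubits cat_uniq.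
move=> /and3P[_ /hasPn /= h1 _].
by have := h1 h.2 (map_f _ hs); rewrite hg map_f.
Qed.

End Operators.

(** * Circuits with and without control *)

Section Cnots.
Variables (Q I : finType) (D : {pred I}) (c t : I -> Q).
Hypotheses (cD : {in D &, injective c}) (tD : {in D &, injective t}).
Hypothesis ct : {in D &, forall i j, c i != t j}.

Definition cnots_of : seq (Q * Q) := [seq (c i, t i) | i <- enum D].

Lemma uniq_cnots_of : uniq (gate_qubits cnots_of).
Proof.
rewrite uniq_gate_qubits cat_uniq -!map_comp !map_inj_in_uniq ?enum_uniq /= ?andbT.
- apply/hasPn => q /mapP[j jD ->]; apply/mapP => -[i iD /= /eqP].
  by rewrite eq_sym; apply/negP/ct; rewrite -mem_enum.
- by move=> i j /= iD jD; apply: tD; rewrite -mem_enum.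
- by move=> i j /= iD jD; apply: cD; rewrite -mem_enum.
Qed.

Lemma cnots_of_target b i : i \in D ->
  cnots_fun cnots_of b (t i) = b (t i) (+) b (c i).
Proof.
move=> iD; rewrite cnots_funE ?uniq_cnots_of // big_map /=.
rewrite big_enum_cond /= (big_pred1 i) // => j /=.
apply/andP/eqP => [[jD /eqP]|->]; first exact: tD.
by rewrite eqxx.
Qed.

Lemma cnots_of_other b q : {in D, forall i, t i != q} -> cnots_fun cnots_of b q = b q.
Proof.
move=> qD; rewrite cnots_funE ?uniq_cnots_of // big_map /=.
rewrite big_enum_cond /= big_pred0 ?addbF // => j /=.
by apply/andP => -[jD]; apply/negP/qD.
Qed.

End Cnots.

Section Implementation.
Variables (R : realType) (Q : finType).
Local Notation C := (Cplx R).
Implicit Types (U V : Op R Q) (c : circuit R Q) (d : nat).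

Lemma circuit_op_cat c c' : circuit_op (c ++ c') = circuit_op c' * circuit_op c.
Proof. by elim: c => [|l c IH] /=; rewrite ?mulr1 // IH mulrA. Qed.

Lemma valid_cat c c' : valid c -> valid c' -> valid (c ++ c').
Proof. by move=> vc vc'; elim: c vc => //= l c IH [vl /IH]. Qed.

Lemma two_qubit_depth_cat c c' :
  two_qubit_depth (c ++ c') = (two_qubit_depth c + two_qubit_depth c')%N.
Proof. exact: count_cat. Qed.

Definition phase (phi : basis Q -> R) : Op R Q := diagop (fun b => expi (phi b)).

Lemma phaseD phi psi : phase (fun b => phi b + psi b) = phase phi * phase psi.
Proof. by rewrite /phase diagopM; apply: eq_diagop => b; rewrite expiD. Qed.

Lemma eq_phase phi psi : phi =1 psi -> phase phi = phase psi.
Proof. by move=> e; apply: eq_diagop => b; rewrite e. Qed.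

Lemma unitary_diag2 (f : bool -> R) : diag2 (fun x => expi (f x)) \is unitarymx.
Proof.
apply/unitarymxP/matrixP => i j; rewrite !mxE !big_ord_recl big_ord0 !mxE.
case: i => [[|[|i]]] //= hi; case: j => [[|[|j]]] //= hj.
- by rewrite rmorph0 mulr0 !addr0 conj_expi -expiD subrr expi0.
- by rewrite !rmorph0 !mul0r !mulr0 !addr0.
- by rewrite !rmorph0 !mul0r !mulr0 !addr0.
- by rewrite rmorph0 mulr0 add0r !addr0 conj_expi -expiD subrr expi0.
Qed.

Lemma implemented_le U d d' : (d <= d')%N ->
  implemented_with_depth U d -> implemented_with_depth U d'.
Proof. by move=> dd' [c [vc cd cU]]; exists c; split=> //; apply: leq_trans dd'. Qed.

Lemma implemented1 : implemented_with_depth (1 : Op R Q) 0.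
Proof. by exists [::]. Qed.

Lemma implementedM U V d e : implemented_with_depth U d ->
  implemented_with_depth V e -> implemented_with_depth (U * V) (d + e).
Proof.
move=> [c [vc cd cU]] [c' [vc' cd' cU']]; exists (c' ++ c); split.
- exact: valid_cat.
- by rewrite two_qubit_depth_cat addnC leq_add.
- by rewrite circuit_op_cat cU cU'.
Qed.

Lemma implemented_tensor (u : Q -> 'M[C]_2) : (forall q, u q \is unitarymx) ->
  implemented_with_depth (tensor u) 0.
Proof. by move=> uU; exists [:: OneQubit u]; split; rewrite //= mul1r. Qed.

Lemma implemented_cnots (s : seq (Q * Q)) : uniq (gate_qubits s) ->
  implemented_with_depth (\prod_(g <- s) cnot R g.1 g.2) 1.
Proof. by move=> us; exists [:: Cnots R s]; split; rewrite //= mul1r. Qed.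

Lemma implemented_phase (f : Q -> bool -> R) :
  implemented_with_depth (phase (fun b => \sum_q f q (b q))) 0.
Proof.
rewrite [phase _](_ : _ = tensor (fun q => diag2 (fun x => expi (f q x)))).
  by apply: implemented_tensor => q; exact: unitary_diag2.
by rewrite tensor_diag2; apply: eq_diagop => b; rewrite expi_sum.
Qed.

Lemma conj_phase_cnots phi (s : seq (Q * Q)) : uniq (gate_qubits s) ->
  let G := \prod_(g <- s) cnot R g.1 g.2 in
  G * phase phi * G = phase (phi \o cnots_fun s).
Proof.
by move=> us; apply: conj_diagop; [exact: cnots_fun_invol | exact: entry_cnots].
Qed.

End Implementation.

(** * Circuits whose ancillas carry copies of the control *)

Section ControlledImplementation.
Variables (R : realType) (A Q : finType).
Local Notation C := (Cplx R).
Implicit Types (U V : Op R Q) (b : basis (option Q)) (a : basis (A + Q)).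

(* |0><0| (x) U0 + |1><1| (x) U1 *)
Definition block U0 U1 : Op R (option Q) :=
  opmx (fun a b : basis (option Q) => if a None != b None then 0
    else entry (if b None then U1 else U0) (target_bits a) (target_bits b)).

Lemma entry_block U0 U1 (a b : basis (option Q)) :
  entry (block U0 U1) a b = if a None != b None then 0
    else entry (if b None then U1 else U0) (target_bits a) (target_bits b).
Proof. exact: entry_opmx. Qed.

Lemma controlled_block U : controlled U = block 1 U.
Proof.
apply: entryP => a b; rewrite entry_block entry_opmx.
by case: ifP => // _; case: (b None); rewrite ?entry1.
Qed.

Definition with_control (x : bool) (b : basis Q) : basis (option Q) :=
  [ffun q => if q is Some q' then b q' else x].

Lemma target_with_control x (b : basis Q) : target_bits (with_control x b) = b.
Proof. by apply/ffunP => q; rewrite !ffunE. Qed.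

Lemma with_control_target b : with_control (b None) (target_bits b) = b.
Proof. by apply/ffunP => -[q|]; rewrite !ffunE. Qed.

Lemma blockM U0 U1 V0 V1 : block U0 U1 * block V0 V1 = block (U0 * V0) (U1 * V1).
Proof.
apply: entryP => a b; rewrite entryM entry_block.
rewrite (bigID (fun c : basis (option Q) => c None == b None)) /=.
rewrite [X in _ + X]big1 => [|c cb]; last by rewrite [X in _ * X]entry_block cb mulr0.
rewrite addr0 (reindex_onto (with_control (b None)) (@target_bits Q)) /=; last first.
  by move=> c /eqP <-; rewrite with_control_target.
rewrite (eq_bigl predT) => [|c]; last by rewrite target_with_control ffunE !eqxx.
under eq_bigr do rewrite !entry_block !target_with_control ffunE eqxx /=.
case: (a None == b None) => /=; last by rewrite big1 // => c _; rewrite mul0r.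
by case: (b None); rewrite entryM.
Qed.

Definition target_part a : basis Q := [ffun q => a (inr q)].

Lemma entry_spread (W : Op R (A + Q)) a b :
  (W *m spread_control R A Q) (enum_rank a) (enum_rank b) = entry W a (copy_control A b).
Proof.
rewrite mxE (bigD1 (enum_rank (copy_control A b))) //= big1 => [|j jb].
  by rewrite !mxE !enum_rankK eqxx mulr1 addr0.
rewrite !mxE enum_rankK (_ : _ == _ = false) ?mulr0 //.
by apply: contraNF jb => /eqP <-; rewrite enum_valK.
Qed.

Lemma spread_block U0 U1 a b :
  (spread_control R A Q *m block U0 U1) (enum_rank a) (enum_rank b) =
  [forall x, a (inl x) == b None]%:R *
    entry (if b None then U1 else U0) (target_part a) (target_bits b).
Proof.
rewrite mxE (reindex (@enum_rank (basis (option Q)))) /=; last first.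
  by exists enum_val => x _; rewrite ?enum_rankK ?enum_valK.
rewrite (bigD1 (with_control (b None) (target_part a))) //= big1 => [|c cb].
  rewrite addr0 mxE !enum_rankK -/(entry _ _ _) entry_block target_with_control ffunE eqxx /=.
  congr (_%:R * _); congr nat_of_bool; apply/eqP/forallP => [-> x|h].
    by rewrite !ffunE.
  by apply/ffunP => -[x|q]; rewrite !ffunE //; apply/eqP.
rewrite mxE !enum_rankK -/(entry _ _ _) entry_block.
case: eqP => [ac|_]; last by rewrite mul0r.
case: eqP => [cN|_] /=; last by rewrite mulr0.
case/eqP: cb; rewrite -(with_control_target c) cN; congr with_control.
by apply/ffunP => q; rewrite ac !ffunE.
Qed.

(** Both blocks are kept because an uncontrolled gate is [block U U]: a controlled circuit is a
    product of such blocks and of controlled phases [block 1 V]. *)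
Definition cimplemented U0 U1 d := exists c : circuit R (A + Q)%type,
  [/\ valid c, (two_qubit_depth c <= d)%N &
   circuit_op c *m spread_control R A Q = spread_control R A Q *m block U0 U1].

Lemma cimplementedM U0 U1 V0 V1 d e : cimplemented U0 U1 d -> cimplemented V0 V1 e ->
  cimplemented (U0 * V0) (U1 * V1) (d + e).
Proof.
move=> [c [vc cd cU]] [c' [vc' cd' cU']]; exists (c' ++ c); split.
- exact: valid_cat.
- by rewrite two_qubit_depth_cat addnC leq_add.
- rewrite circuit_op_cat -[circuit_op c * _]/(_ *m _) -mulmxA cU' mulmxA cU.
  by rewrite -mulmxA -blockM.
Qed.

Lemma spread_blockP (W : Op R (A + Q)) U0 U1 :
  (forall a b, entry W a (copy_control A b) =
    [forall x, a (inl x) == b None]%:R *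
    entry (if b None then U1 else U0) (target_part a) (target_bits b)) ->
  W *m spread_control R A Q = spread_control R A Q *m block U0 U1.
Proof.
move=> h; apply/matrixP => i j; rewrite -(enum_valK i) -(enum_valK j).
by rewrite entry_spread spread_block.
Qed.

Lemma cimplemented_tensor (u : Q -> 'M[C]_2) : (forall q, u q \is unitarymx) ->
  cimplemented (tensor u) (tensor u) 0.
Proof.
move=> uU; exists [:: OneQubit (fun x : A + Q => if x is inr q then u q else 1%:M)].
split=> //=; first by split=> // -[x|q] //; apply/unitarymxP; rewrite mul1mx trmx1 map_mx1.
rewrite mul1r; apply: spread_blockP => a b; rewrite if_same !entry_tensor.
rewrite big_sumType /=; congr (_ * _); last first.
  by apply: eq_bigr => q _; rewrite !ffunE.
transitivity (\prod_(x : A) ((a (inl x) == b None)%:R : C)).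
  apply: eq_bigr => x _; rewrite !ffunE mxE -val_eqE /= !inordK ?ltnS ?leq_b1 //.
  by case: (a _); case: (b _).
case: forallP => [h|/forallP]; first by rewrite big1 // => x _; rewrite h.
by rewrite negb_forall => /existsP[x /negPf hx]; rewrite (bigD1 x) //= hx mul0r.
Qed.

Lemma cimplemented_cnots (s : seq (Q * Q)) : uniq (gate_qubits s) ->
  let G := \prod_(g <- s) cnot R g.1 g.2 in cimplemented G G 1.
Proof.
move=> us G; pose s' : seq ((A + Q) * (A + Q)) := [seq (inr g.1, inr g.2) | g <- s].
exists [:: Cnots R s']; split=> //=.
  split=> //; rewrite (_ : gate_qubits s' = map inr (gate_qubits s)).
    by rewrite map_inj_uniq // => x y [].
  by rewrite /gate_qubits map_flatten -!map_comp.
rewrite mul1r; apply: spread_blockP => a b; rewrite if_same !entry_cnots -natrM mulnb.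
have -> : cnots_fun s' (copy_control A b) =
    copy_control A (with_control (b None) (cnots_fun s (target_bits b))).
  rewrite /s'; elim: s {us G s'} => [|g s IH] /=; first by rewrite with_control_target.
  rewrite IH; apply/ffunP => -[x|q]; rewrite !ffunE //=.
congr (_%:R); congr nat_of_bool; apply/eqP/andP => [->|[/forallP h /eqP e]].
  split; first by apply/forallP => x; rewrite !ffunE.
  by apply/eqP/ffunP => q; rewrite !ffunE.
apply/ffunP => -[x|q]; rewrite !ffunE; first exact/eqP.
by rewrite -e ffunE.
Qed.

(** Only the values of [phi'] on the image of the isometry matter, that is, on states where every
    ancilla equals the control. *)
Lemma cimplemented_phase (phi : basis Q -> R) (phi' : basis (A + Q) -> R) d :
  (forall b, phi' (copy_control A b) = if b None then phi (target_bits b) else 0) ->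
  implemented_with_depth (phase phi') d -> cimplemented 1 (phase phi) d.
Proof.
move=> h [c [vc cd cU]]; exists c; split=> //; rewrite cU.
apply: spread_blockP => a b; rewrite entry_diagop.
have ab : (a == copy_control A b) =
    [forall x, a (inl x) == b None] && (target_part a == target_bits b).
  apply/eqP/andP => [->|[/forallP h' /eqP e]].
    split; first by apply/forallP => x; rewrite !ffunE.
    by apply/eqP/ffunP => q; rewrite !ffunE.
  apply/ffunP => -[x|q]; rewrite !ffunE; first exact/eqP.
  by move/ffunP: e => /(_ q); rewrite !ffunE.
case: eqP ab => [->|_]; last first.
  case: forallP => _ /= ab; last by rewrite mul0r.
  by case: (b None); rewrite ?entry1 ?entry_diagop -ab mulr0.
move/esym/andP => [-> /eqP ->]; rewrite mul1r h.
by case: (b None); rewrite ?entry1 ?entry_diagop eqxx // expi0.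
Qed.

End ControlledImplementation.

(** * Cost rules shared by plain and controlled circuits *)

Section CostModel.
Variables (R : realType) (K : finType).
Local Notation C := (Cplx R).
Local Notation Q := (K * 'I_6)%type.

(* What the circuit and the controlled circuit have in common: conjugation by
   gates costs the same in both, and only the elementary phases have to be
   controlled, at the price f0. *)
Record cost_model (f0 : nat) (P : Op R Q -> nat -> Prop) : Prop := CostModel {
  cost_le : forall U d d', (d <= d')%N -> P U d -> P U d';
  cost1 : P 1 0;
  costM : forall U V d e, P U d -> P V e -> P (U * V) (d + e)%N;
  cost_tensor : forall (u : Q -> 'M[C]_2) U d, (forall q, u q \is unitarymx) ->
    P U d -> P (tensor u * U * (tensor u)^t*) d;
  cost_cnots : forall (s : seq (Q * Q)) U d, uniq (gate_qubits s) -> P U d ->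
    P ((\prod_(g <- s) cnot R g.1 g.2) * U * (\prod_(g <- s) cnot R g.1 g.2)) d.+2;
  cost_base : forall (s : 'I_6) (g : K -> bool -> R),
    P (phase (fun b => \sum_k g k (b (k, s)))) f0 }.

Lemma sum_site_qubit (s : 'I_6) (g : K -> bool -> R) (b : basis Q) :
  \sum_(q : Q) (if q.2 == s then g q.1 (b q) else 0) = \sum_k g k (b (k, s)).
Proof.
rewrite (eq_bigr (fun p => if p.2 == s then g p.1 (b (p.1, p.2)) else 0)) => [|[]//].
rewrite -(pair_bigA _ (fun k q => if q == s then g k (b (k, q)) else 0)) /=.
by apply: eq_bigr => k _; rewrite -big_mkcond big_pred1_eq.
Qed.

Lemma implemented_cost_model : cost_model 0 (@implemented_with_depth R Q).
Proof.
split.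
- exact: implemented_le.
- exact: implemented1.
- by move=> U V d e; exact: implementedM.
- move=> u U d uU UP; rewrite -[d]add0n -[(_ + d)%N]addn0 tensor_trmxC.
  apply: implementedM; last first.
    by apply: implemented_tensor => q; rewrite trmxC_unitary.
  by apply: implementedM => //; exact: implemented_tensor.
- move=> s U d us UP; have -> : d.+2 = (1 + d + 1)%N by rewrite addn1.
  apply: implementedM; last exact: implemented_cnots.
  by apply: implementedM => //; exact: implemented_cnots.
- move=> s g; rewrite (eq_phase (psi := fun b : basis Q => \sum_(q : Q)
    (if q.2 == s then g q.1 (b q) else 0))) => [|b]; last by rewrite sum_site_qubit.
  exact: (implemented_phase (fun (q : Q) x => if q.2 == s then g q.1 x else 0)).
Qed.

Lemma controlled_base (s : 'I_6) (g : K -> bool -> R) :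
  cimplemented K 1 (phase (fun b : basis Q => \sum_k g k (b (k, s)))) 2.
Proof.
(* A function of one bit is affine: [g k x] is [g k false] + 2 h x. With control y it must become y
   times this, and 2xy = x + y - (x xor y). [one] collects the terms in x and in y, [two] the parity
   term. The constant [g k false], a global phase without control, becomes a phase on the ancilla of
   site [k]. *)
pose h k : R := (g k true - g k false) / 2.
pose c (k : K) : K + Q := inl k; pose t (k : K) : K + Q := inr (k, s).
pose G := cnots_of predT c t.
pose one (q : K + Q) (x : bool) : R := match q with
  | inl k => if x then g k false + h k else 0
  | inr (k, q') => if q' == s then (if x then h k else 0) else 0 end.
pose two (q : K + Q) (x : bool) : R := match q with
  | inl k => 0 | inr (k, q') => if q' == s then (if x then - h k else 0) else 0 end.
have sumE (f : K + Q -> bool -> R) (f' : K -> bool -> R) (b : basis (K + Q)) :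
    (forall k q x, f (inr (k, q)) x = if q == s then f' k x else 0) ->
    \sum_q f q (b q) = \sum_k (f (inl k) (b (inl k)) + f' k (b (inr (k, s)))).
  move=> fE; rewrite big_sumType /= big_split /=; congr (_ + _).
  have := sum_site_qubit s f' [ffun q => b (inr q)].
  rewrite [X in _ = X](eq_bigr (fun k => f' k (b (inr (k, s))))) => [<-|k _].
    by apply: eq_bigr => -[k q] _; rewrite fE ffunE.
  by rewrite ffunE.
have uG : uniq (gate_qubits G).
  by apply: uniq_cnots_of => // i j _ _ [].
have Gt b k : cnots_fun G b (inr (k, s)) = b (inr (k, s)) (+) b (inl k).
  by rewrite (cnots_of_target (c := c) (t := t)) // => i j _ _ [].
apply: (@cimplemented_phase _ _ _ _ (fun b : basis (K + Q) =>
   \sum_q one q (b q) + \sum_q two q (cnots_fun G b q))).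
  move=> b; rewrite (sumE _ (fun k x => if x then h k else 0)); last by [].
  rewrite (sumE _ (fun k x => if x then - h k else 0)); last by [].
  rewrite -big_split /=; case bN: (b None); last first.
    rewrite big1 // => k _; rewrite Gt !ffunE bN addbF.
    by case: (b _); rewrite !add0r ?subrr ?addr0.
  apply: eq_bigr => k _; rewrite Gt !ffunE bN addbT /h.
  by case: (b _) => /=; field.
rewrite phaseD; apply: (@implementedM _ _ _ _ 0 2).
  exact: implemented_phase.
rewrite -[phase _](conj_phase_cnots (fun b : basis (K + Q) => \sum_q two q (b q)) uG).
apply: (@implementedM _ _ _ _ (1 + 0) 1); last exact: implemented_cnots.
apply: implementedM; [exact: implemented_cnots | exact: implemented_phase].
Qed.

(** The conjugating gates act on both blocks and cancel in the block where the control is 0, whose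
    entry therefore stays 1. *)
Lemma controlled_cost_model :
  cost_model 2 (fun U d => cimplemented K (1 : Op R Q) U d).
Proof.
split.
- by move=> U d d' dd' [c [vc cd cU]]; exists c; split=> //; apply: leq_trans dd'.
- rewrite -[X in cimplemented _ _ X](tensor1 R Q) -[X in cimplemented _ X](tensor1 R Q).
  by apply: cimplemented_tensor => q; apply/unitarymxP; rewrite mul1mx trmx1 map_mx1.
- by move=> U V d e; rewrite -{3}[1]mulr1; exact: cimplementedM.
- move=> u U d uU UP; have tu := tensor_unitary uU.
  rewrite [X in cimplemented _ X](_ : 1 = tensor u * 1 * (tensor u)^t*); last first.
    by rewrite mulr1; apply/esym/unitarymxP.
  rewrite -[d]add0n -[(_ + d)%N]addn0; apply: cimplementedM; last first.
    rewrite tensor_trmxC; by apply: cimplemented_tensor => q; rewrite trmxC_unitary.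
  by apply: cimplementedM => //; exact: cimplemented_tensor.
- move=> s U d us UP; have -> : d.+2 = (1 + d + 1)%N by rewrite addn1.
  rewrite [X in cimplemented _ X](_ : 1 =
    (\prod_(g <- s) cnot R g.1 g.2) * 1 * (\prod_(g <- s) cnot R g.1 g.2)); last first.
    rewrite mulr1; apply/esym/conj_cnots_invol; last exact: entry_cnots.
    exact: cnots_fun_invol.
  apply: cimplementedM; last exact: (@cimplemented_cnots R K _ s us).
  by apply: cimplementedM => //; exact: (@cimplemented_cnots R K _ s us).
- exact: controlled_base.
Qed.

Section Phases.
Variables (f0 : nat) (P : Op R Q -> nat -> Prop).
Hypothesis PM : cost_model f0 P.

Lemma cost_phase_cnots (s : seq (Q * Q)) (phi : basis Q -> R) d :
  uniq (gate_qubits s) -> P (phase phi) d -> P (phase (phi \o cnots_fun s)) d.+2.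
Proof. by move=> us /(cost_cnots PM us); rewrite conj_phase_cnots. Qed.

Variables (s : 'I_6) (N : K -> 'I_6 -> bool).

(** [N] lets the qubits taking part vary from site to site, since the two ends of a bond carry
    different letters. *)
Definition site_parity (r : seq 'I_6) (b : basis Q) (k : K) : bool :=
  b (k, s) (+) \big[addb/false]_(q <- r | N k q) b (k, q).

(** A CNOT layer merely substitutes bits inside the phase, so [Phi] can be arbitrary. Each qubit [q]
    of [r] takes one layer, acting on all sites with [N k q] at once, and the same layer again to
    undo it. *)
Lemma cost_site_parity (Phi : (K -> bool) -> R) d (r : seq 'I_6) : s \notin r ->
  P (phase (fun b => Phi (fun k => b (k, s)))) d ->
  P (phase (fun b => Phi (site_parity r b))) (d + (size r).*2).
Proof.
move=> sr Pd; elim: r sr => [|q r IH].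
  rewrite addn0; set U := phase _; suff -> : U = phase (fun b => Phi (fun k => b (k, s))) by [].
  apply: eq_phase => b; congr Phi; apply/funext => k.
  by rewrite /site_parity big_nil addbF.
rewrite inE negb_or => /andP[sq sr]; rewrite /= doubleS !addnS.
pose D : {pred K} := [pred k | N k q].
pose c (k : K) := (k, q); pose t (k : K) := (k, s).
have cD : {in D &, injective c} by move=> i j _ _ [].
have tD : {in D &, injective t} by move=> i j _ _ [].
have ct : {in D &, forall i j, c i != t j}.
  by move=> i j _ _; rewrite xpair_eqE negb_and (eq_sym q) sq orbT.
have := cost_phase_cnots (uniq_cnots_of cD tD ct) (IH sr).
rewrite [phase (_ \o _)](eq_phase (psi := fun b => Phi (site_parity (q :: r) b))) //.
move=> b /=; congr Phi; apply/funext => k; rewrite /site_parity big_cons.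
have -> : cnots_fun (cnots_of D c t) b (k, s) = b (k, s) (+) (N k q && b (k, q)).
  case: (boolP (N k q)) => Nk; first exact: (cnots_of_target cD tD ct b Nk).
  rewrite addbF; apply: cnots_of_other => // i iD.
  by apply: contraNneq Nk => -[<-].
rewrite -addbA; congr (_ (+) _).
(* The qubits of [r] are not targets, because [s] is not among them, so their bits are unchanged. *)
rewrite [X in _ (+) X](_ : _ = \big[addb/false]_(q0 <- r | N k q0) b (k, q0)).
  by case: (N k q).
rewrite big_seq_cond [RHS]big_seq_cond; apply: eq_bigr => q' /andP[q'r _].
apply: cnots_of_other => // i _; rewrite xpair_eqE negb_and orbC.
by apply/orP; left; apply: contraNneq sr => ->.
Qed.

End Phases.

End CostModel.

(** * Sums of Pauli strings *)

Section Pauli.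
Variable R : realType.
Local Notation C := (Cplx R).

Lemma mx2M (a b c d a' b' c' d' : C) : mx2 a b c d * mx2 a' b' c' d' =
  mx2 (a * a' + b * c') (a * b' + b * d') (c * a' + d * c') (c * b' + d * d').
Proof.
apply/matrixP => i j; rewrite !mxE !big_ord_recl big_ord0 !mxE /= addr0.
by case: (i == 0); case: (j == 0).
Qed.

Lemma mx2_trmxC (a b c d : C) : (mx2 a b c d)^t* = mx2 a^* c^* b^* d^*.
Proof.
apply/matrixP => i j; rewrite !mxE.
by case: (i == 0); case: (j == 0).
Qed.

Lemma mx2Z (x a b c d : C) : x *: mx2 a b c d = mx2 (x * a) (x * b) (x * c) (x * d).
Proof.
apply/matrixP => i j; rewrite !mxE.
by case: (i == 0); case: (j == 0).
Qed.

Lemma mx2_1 : 1 = mx2 1 0 0 1 :> 'M[C]_2.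
Proof.
apply/matrixP => i j; rewrite !mxE.
by case: i => [[|[|i]]] //= hi; case: j => [[|[|j]]].
Qed.

Inductive pauli := PI | PX | PY | PZ.

Definition nontrivial p := if p is PI then false else true.

Definition pauli_mx p : 'M[C]_2 := match p with
  | PI => 1 | PX => mx2 0 1 1 0 | PY => mx2 0 (- 'i) 'i 0 | PZ => mx2 1 0 0 (-1) end.

Definition anticommute p p' : bool := match p, p' with
  | PX, PY | PX, PZ | PY, PX | PY, PZ | PZ, PX | PZ, PY => true
  | _, _ => false end.

Lemma pauli_mx_comm p p' :
  pauli_mx p * pauli_mx p' = (-1) ^+ anticommute p p' *: (pauli_mx p' * pauli_mx p).
Proof.
case: p; case: p'; rewrite /= ?mulr1 ?mul1r ?expr0 ?expr1 ?scale1r // !mx2M ?mx2Z;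
  congr mx2; ring.
Qed.

Lemma pauli_mx_trmxC p : (pauli_mx p)^t* = pauli_mx p.
Proof.
case: p; rewrite /= ?mx2_trmxC ?rmorphN /= ?rmorph1 ?rmorph0 ?conjCi ?opprK //.
by rewrite trmx1 map_mx1.
Qed.

Definition inv_sqrt2 : C := (Num.sqrt (2^-1 : R))%:C%C.

Lemma inv_sqrt2_sqr : inv_sqrt2 * inv_sqrt2 = 2^-1.
Proof.
rewrite -rmorphM /= -expr2 sqr_sqrtr ?invr_ge0 ?ler0n //.
by rewrite fmorphV rmorph_nat.
Qed.

Lemma inv_sqrt2_conj : inv_sqrt2^* = inv_sqrt2.
Proof. exact: conj_real_complex. Qed.

(* [(P + Z) / sqrt 2] is an involution exchanging Z and the Pauli matrix P. *)
Definition clifford p : 'M[C]_2 := let r := inv_sqrt2 in match p with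
  | PX => mx2 r r r (- r) | PY => mx2 r (- 'i * r) ('i * r) (- r) | _ => 1 end.

Lemma clifford_trmxC p : (clifford p)^t* = clifford p.
Proof.
case: p; rewrite /= ?mx2_trmxC ?rmorphM ?rmorphN /= ?inv_sqrt2_conj ?conjCi ?opprK //.
all: by rewrite trmx1 map_mx1.
Qed.

Lemma clifford_sqr p : clifford p * clifford p = 1.
Proof.
have r2 := inv_sqrt2_sqr; have i2 := sqrCi C; rewrite expr2 in i2.
case: p; rewrite /= ?mulr1 // mx2M mx2_1; congr mx2; try ring.
- by rewrite r2; field.
- by rewrite mulrNN r2; field.
- by rewrite r2 mulrACA mulNr i2 r2; field.
- by rewrite mulrNN r2 mulrACA mulrN i2 r2; field.
Qed.

Lemma clifford_unitary p : clifford p \is unitarymx.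
Proof. by apply/unitarymxP; rewrite clifford_trmxC; exact: clifford_sqr. Qed.

Lemma clifford_conj p : nontrivial p ->
  clifford p * pauli_mx PZ * clifford p = pauli_mx p.
Proof.
have r2 := inv_sqrt2_sqr; have i2 := sqrCi C; rewrite expr2 in i2.
case: p => //= _; rewrite ?mulr1 ?mul1r // !mx2M; congr mx2; try ring.
- transitivity (2 * (inv_sqrt2 * inv_sqrt2)); first ring.
  by rewrite r2; field.
- transitivity (2 * (inv_sqrt2 * inv_sqrt2)); first ring.
  by rewrite r2; field.
- transitivity ((inv_sqrt2 * inv_sqrt2) * (1 + 'i * 'i)); first ring.
  by rewrite i2 subrr mulr0.
- transitivity (- 'i * (2 * (inv_sqrt2 * inv_sqrt2))); first ring.
  by rewrite r2; field.
- transitivity ('i * (2 * (inv_sqrt2 * inv_sqrt2))); first ring.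
  by rewrite r2; field.
- transitivity (- (inv_sqrt2 * inv_sqrt2) * (1 + 'i * 'i)); first ring.
  by rewrite i2 subrr mulr0.
Qed.

End Pauli.

Section ExpDiag.
Variables (R : realType) (Q : finType).
Local Notation C := (Cplx R).

Lemma exp_conj_diagop (W : Op R Q) (phi : basis Q -> R) : W \is unitarymx ->
  expmx_mi (W * diagop (fun b => (phi b)%:C%C) * W^t*) =
  W * phase (fun b => - phi b) * W^t*.
Proof.
move=> WU; have WU' : W^t* \is unitarymx by rewrite trmxC_unitary.
have diagE (f : basis Q -> C) : diagop f = diag_mx (\row_j f (enum_val j)).
  by apply/matrixP => i j; rewrite !mxE (inj_eq enum_val_inj); case: eqP.
have := exp_unitary_diag (fun j => phi (enum_val j)) WU'.
by rewrite /unitary_diag trmxCK -(diagE (fun b => (phi b)%:C%C))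
  -(diagE (fun b => expi (- phi b))).
Qed.

End ExpDiag.

Section Strings.
Variables (R : realType) (K I : finType) (D : {pred I}) (e1 e2 : I -> K).
Local Notation C := (Cplx R).
Local Notation Q := (K * 'I_6)%type.
Hypotheses (e1D : {in D &, injective e1}) (e2D : {in D &, injective e2}).
Hypothesis e12 : {in D &, forall i j, e1 i != e2 j}.


Definition pstring (l1 l2 : 'I_6 -> pauli) (i : I) : Op R Q :=
  tensor (fun q : Q => if q.1 == e1 i then pauli_mx R (l1 q.2)
    else if q.1 == e2 i then pauli_mx R (l2 q.2) else 1).

Lemma pstring_trmxC l1 l2 i : (pstring l1 l2 i)^t* = pstring l1 l2 i.
Proof.
rewrite tensor_trmxC; apply: eq_tensor => q.
by do 2![case: ifP => _; rewrite ?pauli_mx_trmxC // ]; rewrite trmx1 map_mx1.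
Qed.

Lemma prod_sites (F G : 'I_6 -> C) (k k' : K) : k != k' ->
  \prod_(q : Q) (if q.1 == k then F q.2 else if q.1 == k' then G q.2 else 1) =
  (\prod_j F j) * (\prod_j G j).
Proof.
move=> kk'.
rewrite -(pair_bigA _ (fun x j => if x == k then F j else if x == k' then G j else 1)) /=.
rewrite (bigD1 k) //= eqxx; congr (_ * _).
rewrite (bigD1 k') /=; last by rewrite eq_sym.
rewrite eq_sym (negPf kk') eqxx [X in _ * X]big1 ?mulr1 // => x.
by move=> /andP[/negPf -> /negPf ->]; rewrite big1.
Qed.

(** On different bonds the supports are disjoint. On the same bond the two products differ by the
    sign -1 to the number of qubits whose letters anticommute, which is even by hypothesis. *)
Lemma pstring_comm l1 l2 m1 m2 (i j : I) : i \in D -> j \in D ->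
  ~~ (\big[addb/false]_q anticommute (l1 q) (m1 q) (+)
      \big[addb/false]_q anticommute (l2 q) (m2 q)) ->
  pstring l1 l2 i * pstring m1 m2 j = pstring m1 m2 j * pstring l1 l2 i.
Proof.
move=> iD jD even; rewrite !tensorM.
have [<-|ij] := eqVneq i j; last first.
  apply: eq_tensor => q; case: (eqVneq q.1 (e1 i)) => [->|qi1].
    rewrite (negPf (e12 iD jD)) (inj_in_eq e1D) // (negPf ij) mulr1 mul1r //.
  case: (eqVneq q.1 (e2 i)) => [->|qi2]; last by rewrite mulr1 mul1r.
  by rewrite eq_sym (negPf (e12 jD iD)) (inj_in_eq e2D) // (negPf ij) mulr1 mul1r.
have sgnE (l m : 'I_6 -> pauli) : \prod_q ((-1) ^+ anticommute (l q) (m q) : C) =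
    (-1) ^+ \big[addb/false]_q anticommute (l q) (m q).
  rewrite (big_morph (fun b : bool => (-1) ^+ b : C) (id1 := 1) (op1 := *%R)) //.
  by move=> x y; rewrite signr_addb.
rewrite (eq_tensor (v := fun q : Q => (if q.1 == e1 i then (-1) ^+ anticommute (l1 q.2) (m1 q.2)
   else if q.1 == e2 i then (-1) ^+ anticommute (l2 q.2) (m2 q.2) else 1) *:
   ((if q.1 == e1 i then pauli_mx R (m1 q.2) else if q.1 == e2 i then pauli_mx R (m2 q.2) else 1) *
   (if q.1 == e1 i then pauli_mx R (l1 q.2) else if q.1 == e2 i then pauli_mx R (l2 q.2) else 1)))).
  rewrite tensorZ (prod_sites (fun j => (-1) ^+ anticommute (l1 j) (m1 j))
    (fun j => (-1) ^+ anticommute (l2 j) (m2 j))) ?e12 //.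
  by rewrite !sgnE -signr_addb (negPf even) expr0 scale1r.
move=> q /=; case: ifP => _; first exact: pauli_mx_comm.
by case: ifP => _; [exact: pauli_mx_comm | rewrite scale1r].
Qed.

Definition string_sum (l1 l2 : 'I_6 -> pauli) : Op R Q := \sum_(i in D) pstring l1 l2 i.

Lemma string_sum_trmxC l1 l2 : (string_sum l1 l2)^t* = string_sum l1 l2.
Proof.
apply: entryP => a b; rewrite entry_trmxC !entry_sum rmorph_sum.
by apply: eq_bigr => i _; rewrite /= -entry_trmxC pstring_trmxC.
Qed.

Lemma string_sum_comm l1 l2 m1 m2 :
  ~~ (\big[addb/false]_q anticommute (l1 q) (m1 q) (+)
      \big[addb/false]_q anticommute (l2 q) (m2 q)) ->
  string_sum l1 l2 * string_sum m1 m2 = string_sum m1 m2 * string_sum l1 l2.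
Proof.
move=> even; rewrite /string_sum mulr_suml mulr_sumr; apply: eq_bigr => i iD.
by rewrite mulr_sumr mulr_suml; apply: eq_bigr => j jD; exact: pstring_comm.
Qed.

Variables (E1 : {pred K}).
Hypotheses (e1E : {in D, forall i, e1 i \in E1}) (e2E : {in D, forall i, e2 i \notin E1}).
Variables (l1 l2 : 'I_6 -> pauli) (s : 'I_6) (r : seq 'I_6).
Hypotheses (ls1 : nontrivial (l1 s)) (ls2 : nontrivial (l2 s)) (sr : s \notin r) (ur : uniq r).
Hypothesis rP : forall q, q != s -> nontrivial (l1 q) || nontrivial (l2 q) -> q \in r.

(** A site outside all bonds gets the letters [l2]; the rotation there is undone by [W^t*]. *)
Let letter k : 'I_6 -> pauli := if k \in E1 then l1 else l2.
Let N k q := nontrivial (letter k q).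
Let W : Op R Q := tensor (fun q : Q => clifford R (letter q.1 q.2)).
Let sgn (x : bool) : R := (-1) ^+ x.

Lemma site_parityE (b : basis Q) k :
  site_parity s N r b k = \big[addb/false]_(q | N k q) b (k, q).
Proof.
have Ns : N k s by rewrite /N /letter; case: ifP.
rewrite (bigD1 s) //=; congr (_ (+) _).
rewrite -big_filter big_uniq ?filter_uniq //; apply: eq_bigl => q.
rewrite mem_filter; case: (boolP (N k q)) => //= Nq.
have [->|qs] := eqVneq q s; first by rewrite (negPf sr).
by rewrite rP // -[_ || _]orbC; move: Nq; rewrite /N /letter; case: ifP => _ ->; rewrite ?orbT.
Qed.

(** [W] maps every nontrivial letter to Z, and a product of Z is the sign of a parity of bits. The
    same [W] works for every [i] because [E1] separates first ends from second ends. *)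
Lemma pstring_diag i : i \in D -> pstring l1 l2 i =
  W * diagop (fun b => (sgn (site_parity s N r b (e1 i) (+) site_parity s N r b (e2 i)))%:C%C)
    * W^t*.
Proof.
move=> iD.
pose f (q : Q) x : C := if ((q.1 == e1 i) || (q.1 == e2 i)) && N q.1 q.2 then (-1) ^+ x else 1.
rewrite (eq_diagop (psi := fun b => \prod_q f q (b q))) => [|b].
  rewrite -(tensor_diag2 f) tensor_trmxC !tensorM; apply: eq_tensor => q.
  rewrite clifford_trmxC; case: (eqVneq q.1 (e1 i)) => [qe|q1].
    rewrite /f qe eqxx /= /N /letter e1E //; case: (boolP (nontrivial _)) => nt.
      by apply/esym; exact: clifford_conj.
    rewrite [diag2 _](_ : _ = 1) ?mulr1 ?clifford_sqr; last by rewrite mx2_1.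
    by case: (l1 _) nt.
  case: (eqVneq q.1 (e2 i)) => [qe|q2].
    rewrite /f qe eqxx orbT /= /N /letter (negPf (e2E iD)); case: (boolP (nontrivial _)) => nt.
      by apply/esym; exact: clifford_conj.
    rewrite [diag2 _](_ : _ = 1) ?mulr1 ?clifford_sqr; last by rewrite mx2_1.
    by case: (l2 _) nt.
  rewrite /f (negPf q1) (negPf q2) /=.
  rewrite [diag2 _](_ : _ = 1) ?mulr1 ?clifford_sqr; last by rewrite mx2_1.
  by [].
have sgnE k : (sgn (site_parity s N r b k))%:C%C =
    \prod_j (if N k j then (-1) ^+ b (k, j) else 1) :> C.
  rewrite site_parityE -big_mkcond /=.
  rewrite (big_morph (fun b : bool => (sgn b)%:C%C : C) (id1 := 1) (op1 := *%R)) //=.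
  - by apply: eq_bigr => j _; rewrite /sgn rmorphXn rmorphN rmorph1.
  - by move=> x y; rewrite /sgn signr_addb rmorphM.
rewrite /sgn signr_addb rmorphM /= !sgnE -(prod_sites _ _ (e12 iD iD)).
apply: eq_bigr => -[k j] _; rewrite /f /=.
case: (eqVneq k (e1 i)) => [->|_] //=.
by case: (eqVneq k (e2 i)) => [->|_].
Qed.

Variables (f0 : nat) (P : Op R Q -> nat -> Prop).
Hypothesis PM : cost_model f0 P.

(** [size r] CNOT layers gather the parity of each site on its qubit [s], and one more adds the
    first end of each bond to its second end, where the phase is applied. Undoing these layers
    doubles the count. *)
Lemma cost_string_sum (c : R) :
  P (expmx_mi ((c%:C%C : C) *: string_sum l1 l2)) (f0 + (size r).+1.*2).
Proof.
pose Phi (y : K -> bool) : R := \sum_(i in D) c * sgn (y (e1 i) (+) y (e2 i)).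
have -> : (c%:C%C : C) *: string_sum l1 l2 =
   W * diagop (fun b => (Phi (site_parity s N r b))%:C%C) * W^t*.
  rewrite /string_sum (eq_bigr _ pstring_diag) -mulr_suml -mulr_sumr diagop_sum.
  rewrite -[RHS]/((_ *m _) *m _) -[LHS]/(_ *: ((_ *m _) *m _)).
  rewrite scalemxAl scalemxAr diagopZ; congr (_ *m _ *m _); apply: eq_diagop => b.
  by rewrite mulr_sumr rmorph_sum /=; apply: eq_bigr => i _; rewrite rmorphM.
have WU : W \is unitarymx by apply: tensor_unitary => q; exact: clifford_unitary.
rewrite exp_conj_diagop //; apply: (cost_tensor PM); first by move=> q; exact: clifford_unitary.
rewrite doubleS -!addSnnS.
apply: (@cost_site_parity R K f0 P PM s N (fun y => - Phi y) _ r sr).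
pose cc (i : I) := (e1 i, s); pose t (i : I) := (e2 i, s).
have cD : {in D &, injective cc} by move=> i j iD jD [] /e1D; apply.
have tD : {in D &, injective t} by move=> i j iD jD [] /e2D; apply.
have ct : {in D &, forall i j, cc i != t j}.
  by move=> i j iD jD; rewrite xpair_eqE negb_and e12.
(* By injectivity of [e2] this sum has at most one term; it is empty, giving no phase, at sites that
   are not second ends. *)
have base := cost_base PM s
  (fun k x => - \sum_(i in D | e2 i == k) c * sgn x).
have := cost_phase_cnots PM (uniq_cnots_of cD tD ct) base.
rewrite [phase (_ \o _)](eq_phase (psi := fun b : basis Q => - Phi (fun k => b (k, s)))) //.
move=> b /=; rewrite sumrN; congr (- _).
rewrite /Phi (partition_big e2 predT) //=; apply: eq_bigr => k _.
apply: eq_bigr => i /andP[iD /eqP <-].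
by rewrite (cnots_of_target cD tD ct) // addbC.
Qed.

End Strings.

(** * The Verstraete-Cirac encoding *)

Section Pair.
Variables (R : realType) (Q : finType).
Local Notation C := (Cplx R).

Definition tensor_pair (u v : Q) (r : Q -> 'M[C]_2) (a b : 'M[C]_2) : Op R Q :=
  tensor (fun q => if q == u then a else if q == v then b else r q).

(** Reduces an identity between operators that agree outside two qubits to an identity between
    entries of 2 by 2 matrices. *)
Lemma tensor_pair_lin (u v : Q) (r : Q -> 'M[C]_2) (a1 b1 a2 b2 a3 b3 a4 b4 : 'M[C]_2) (c3 c4 : C) :
  u != v ->
  (forall x x' y y', a1 x x' * b1 y y' + a2 x x' * b2 y y' =
     c3 * (a3 x x' * b3 y y') + c4 * (a4 x x' * b4 y y')) ->
  tensor_pair u v r a1 b1 + tensor_pair u v r a2 b2 =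
  c3 *: tensor_pair u v r a3 b3 + c4 *: tensor_pair u v r a4 b4.
Proof.
move=> uv h; apply: entryP => x y; rewrite !entryD !entryZ !entry_tensor.
have split a b : \prod_q (if q == u then a else if q == v then b else r q) (inord (x q)) (inord (y q))
    = a (inord (x u)) (inord (y u)) * b (inord (x v)) (inord (y v)) *
      \prod_(q | (q != u) && (q != v)) r q (inord (x q)) (inord (y q)) :> C.
  rewrite (bigD1 u) //= eqxx (bigD1 v) /=; last by rewrite eq_sym.
  rewrite eq_sym (negPf uv) eqxx mulrA; congr (_ * _).
  by apply: eq_bigr => q /andP[/negPf -> /negPf ->].
by rewrite !split -mulrDl h; ring.
Qed.

Lemma mul_opZl (x : C) (U V : Op R Q) : (x *: U) * V = x *: (U * V).
Proof. exact/esym/scalemxAl. Qed.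

Lemma mul_opZr (x : C) (U V : Op R Q) : U * (x *: V) = x *: (U * V).
Proof. exact/esym/scalemxAr. Qed.

End Pair.

(** * The snake path and the bonds of a hopping layer *)

Section Lattice.
Variable L : nat.
Local Notation site := (site L).

Lemma mirrorK b : {in [pred k | (k < L)%N], cancel (mirror L b) (mirror L b)}.
Proof. by move=> k; rewrite inE /mirror; case: b => // kL; rewrite subKn // -ltnS prednK // (leq_ltn_trans _ kL). Qed.

Lemma mirror_lt b k : (k < L)%N -> (mirror L b k < L)%N.
Proof.
rewrite /mirror; case: b => // kL.
by rewrite (leq_ltn_trans (leq_subr _ _)) // prednK // (leq_ltn_trans _ kL).
Qed.

Lemma eq_mixed_radix a b m n : (m < L)%N -> (n < L)%N -> (a * L + m = b * L + n)%N -> a = b /\ m = n.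
Proof.
move=> mL nL e; have L0 : (0 < L)%N by apply: leq_ltn_trans mL.
have /(congr1 (divn^~ L)) := e; rewrite !divnMDl // !divn_small // !addn0 => ab.
by split=> //; move: e; rewrite ab => /addnI.
Qed.

Lemma snake_inj : injective (@snake L).
Proof.
move=> i j; rewrite /snake.
case/eq_mixed_radix => [||]; try exact: mirror_lt.
move=> row; rewrite row => mx; case/eq_mixed_radix: row => [||]; try exact: mirror_lt.
move=> z my.
have mirror_inj b k k' : (k < L)%N -> (k' < L)%N -> mirror L b k = mirror L b k' -> k = k'.
  by move=> kL k'L e; rewrite -(mirrorK b kL) e mirrorK.
apply/ffunP => e; apply: val_inj.
have := mirror_inj _ _ _ (ltn_ord _) (ltn_ord _) mx.
move: my; rewrite z => /mirror_inj my'; have {my'} := my' (ltn_ord _) (ltn_ord _).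
case: e => -[|[|[|e]]] // he.
- by move=> _; rewrite (_ : Ordinal he = ax_x) //; apply: val_inj.
- by move=> + _; rewrite (_ : Ordinal he = ax_y) //; apply: val_inj.
- by move=> _ _; rewrite (_ : Ordinal he = ax_z) //; apply: val_inj.
Qed.

(** A step along x stays within one row, which the path runs through forwards or backwards. *)
Lemma next_along_x (i j : site) : next_along ax_x i j ->
  snake j = (snake i).+1 \/ snake i = (snake j).+1.
Proof.
move=> /andP[/eqP xj /forallP h].
have eqc e : e != ax_x -> i e = j e by move=> ne; apply/eqP; apply: implyP (h e) ne.
rewrite /snake -(eqc ax_y) // -(eqc ax_z) // xj /=.
move: (i ax_z * L + mirror L (odd (i ax_z)) (i ax_y))%N => row.
rewrite /mirror; case: ifP => _; last by left; rewrite addnS.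
right; rewrite -addnS; congr (_ + _)%N.
(* The bound on the coordinate keeps the truncated subtraction in [mirror] exact. *)
have := ltn_ord (j ax_x); rewrite xj; clear; move: (nat_of_ord (i ax_x)) => k.
lia.
Qed.

Lemma bond_x (i j : site) : bond ax_x i j -> snake j = (snake i).+1.
Proof. by case/andP => /orP[]/next_along_x[] -> //; rewrite ltnNge leqnSn. Qed.

(* The other end of the bond through i in a layer of alternating bonds. *)
Definition partner (d : 'I_3) (p : bool) (i j : site) : Prop :=
  (forall e, e != d -> j e = i e) /\
  (j d = (if odd (i d) == p then (i d).+1 else (i d).-1) :> nat).

Lemma partner_uniq d p i j j' : partner d p i j -> partner d p i j' -> j = j'.
Proof.
move=> [jo jd] [jo' jd']; apply/ffunP => e; have [->|ed] := eqVneq e d.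
  by apply: val_inj; rewrite /= jd jd'.
by rewrite jo // jo'.
Qed.

(** The coordinate along [d] has parity [p] at the lower end of the bond and the opposite parity at
    the upper end, so it tells in which direction the other end lies. *)
Lemma bond_partner d p (i j : site) : bond d i j -> bond_parity d i j == p ->
  partner d p i j /\ partner d p j i.
Proof.
have next x y : next_along d x y -> bond_parity d x y == p ->
    partner d p x y /\ partner d p y x.
  case/andP => /eqP yx /forallP h; rewrite /bond_parity yx (minn_idPl (leqnSn _)) => xp.
  have eqc e : e != d -> x e = y e by move=> ne; apply/eqP; apply: implyP (h e) ne.
  split; split.
  - by move=> e /eqc.
  - by rewrite xp yx.
  - by move=> e /eqc.
  - rewrite yx /= -(eqP xp); by case: (odd _).
case/andP => /orP[nx|nx] _ par; first exact: next.
suff [] : partner d p j i /\ partner d p i j by [].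
by apply: next => //; rewrite /bond_parity minnC.
Qed.

Definition layer_bonds (d : 'I_3) (p : bool) : {pred site * site} :=
  [pred b | bond d b.1 b.2 && (bond_parity d b.1 b.2 == p)].

Lemma layer_bonds_fst_inj d p : {in layer_bonds d p &, injective fst}.
Proof.
move=> [i j] [i' j'] /andP[/= b bp] /andP[/= b' bp'] ii'; subst i'.
have [h _] := bond_partner b bp; have [h' _] := bond_partner b' bp'.
by rewrite (partner_uniq h h').
Qed.

Lemma layer_bonds_snd_inj d p : {in layer_bonds d p &, injective snd}.
Proof.
move=> [i j] [i' j'] /andP[/= b bp] /andP[/= b' bp'] jj'; subst j'.
have [_ h] := bond_partner b bp; have [_ h'] := bond_partner b' bp'.
by rewrite (partner_uniq h h').
Qed.

(** The other ends of both bonds would be the unique partner of the common site, which would lie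
    both after and before it on the path. *)
Lemma layer_bonds_disjoint d p : {in layer_bonds d p &, forall b b', b.1 != b'.2}.
Proof.
move=> [i j] [i' j'] /andP[/= b bp] /andP[/= b' bp']; apply/eqP => ij'; subst j'.
have [h _] := bond_partner b bp; have [_ h'] := bond_partner b' bp'.
move: b' bp'; rewrite -(partner_uniq h h') => /andP[_ lt] _.
by move: b => /andP[_ /(ltn_trans lt)]; rewrite ltnn.
Qed.

End Lattice.

(** * Jordan-Wigner form of the encoded operators *)

Section Hop.
Variables (R : realType) (L : nat).
Local Notation C := (Cplx R).
Local Notation Q := (site L * 'I_6)%type.
Local Notation Z := (pauli_mx R PZ).

(* The Jordan-Wigner form shared by all the encoded fermionic operators. *)
Definition jw (m : 'I_6) (j : site L) (u : 'M[C]_2) (q : Q) : 'M[C]_2 :=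
  if (snake q.1 < snake j)%N then Z else
  if q.1 == j then (if (q.2 < m)%N then Z else if q.2 == m then u else 1) else 1.

Definition lower : 'M[C]_2 := mx2 0 1 0 0.

Lemma prod_delta (I : finType) (P : pred I) (i0 : I) (u : 'M[C]_2) :
  \prod_(i | P i) (if i0 == i then u else 1) = if P i0 then u else 1.
Proof.
rewrite -big_mkcondr /=; case: (boolP (P i0)) => Pi0.
  by rewrite (big_pred1 i0) // => i /=; rewrite eq_sym; case: eqP => [->|]; rewrite ?andbT ?andbF.
by rewrite big_pred0 // => i /=; case: eqP => [<-|]; rewrite ?(negPf Pi0) ?andbF.
Qed.

Lemma singleE (q0 : Q) (u : 'M[C]_2) : single q0 u = tensor (fun q => if q == q0 then u else 1).
Proof. by []. Qed.

Lemma vc_SE j : vc_S R j = tensor (fun q : Q => if (snake q.1 < snake j)%N then Z else 1).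
Proof.
rewrite /vc_S.
rewrite (eq_bigr (fun i => tensor (fun q : Q => if q.1 == i then Z else 1))) => [|i _].
  by rewrite tensor_prod; apply: eq_tensor => q; rewrite prod_delta.
rewrite (eq_bigr (fun q0 : 'I_6 => tensor (fun q : Q => if q == (i, q0) then Z else 1))) => //.
rewrite tensor_prod; apply: eq_tensor => -[k q] /=.
rewrite (eq_bigr (fun q0 => if k == i then (if q == q0 then Z else 1) else 1)) => [|q0 _].
  by case: eqP => _; [rewrite prod_delta | rewrite big1].
by rewrite xpair_eqE; case: (k == i).
Qed.

Lemma prod_fermionZ (P : pred nat) j :
  \prod_(s : 'I_4 | P s) vcZ R j (fermion s) =
  tensor (fun q : Q => if (q.1 == j) && ((q.2 < 4)%N && P q.2) then Z else 1).
Proof.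
rewrite (eq_bigr (fun s => tensor (fun q : Q => if q == (j, fermion s) then Z else 1))) //.
rewrite tensor_prod; apply: eq_tensor => -[k q] /=.
case: (ltnP q 4) => q4; last first.
  rewrite andbF big1 // => s _; case: eqP => // -[_ e].
  by move: q4; rewrite e leqNgt /= ltn_ord.
rewrite (eq_bigr (fun s => if k == j then (if Ordinal q4 == s then Z else 1) else 1)) => [|s _].
  by case: eqP => _ /=; [rewrite prod_delta | rewrite big1].
by rewrite xpair_eqE -val_eqE /=; case: (k == j).
Qed.

Lemma vc_aE s j : vc_a R s j = tensor (jw (fermion s) j lower).
Proof.
have lowerE : 2^-1 *: (vcX R j (fermion s) + 'i *: vcY R j (fermion s)) =
    single ((j, fermion s) : Q) lower.
  rewrite /vcX /vcY /pX /pY.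
  apply: entryP => a b; rewrite entryZ entryD entryZ !entry_tensor.
  rewrite !(bigD1 (P := predT) ((j, fermion s) : Q)) //= !eqxx.
  have rest (u : 'M[C]_2) : \prod_(q | q != ((j, fermion s) : Q)) (if q == (j, fermion s) then u else 1%:M)
      (inord (a q)) (inord (b q)) = \prod_(q | q != ((j, fermion s) : Q)) (1%:M : 'M[C]_2) (inord (a q)) (inord (b q)).
    by apply: eq_bigr => q /negPf ->.
  rewrite !rest mulrA -mulrDl mulrA; congr (_ * _); rewrite /lower !mxE.
  have i2 := sqrCi C; rewrite expr2 in i2.
  case: (inord (a _) == 0); case: (inord (b _) == 0); rewrite /= ?mulr0 ?addr0 ?mulr0 ?mulrN ?i2 ?opprK ?subrr ?mulr0 //.
  by rewrite mulVf // pnatr_eq0.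
rewrite /vc_a -mul_opZr lowerE vc_SE (prod_fermionZ (fun x => x < s)%N) singleE !tensorM.
apply: eq_tensor => -[k q]; rewrite /jw /= xpair_eqE.
case: (eqVneq k j) => [->|_] /=; last by rewrite !mulr1.
rewrite ltnn mul1r -[q == _]val_eqE /=.
case: (ltngtP q s) => [qs|qs|->] /=; rewrite ?andbF ?mulr1 ?mul1r //.
by rewrite (leq_trans qs) // -ltnS ltnW // ltnS.
Qed.

Lemma vc_TE j : vc_T R j = tensor (jw mu j 1).
Proof.
rewrite /vc_T vc_SE (prod_fermionZ predT) tensorM.
apply: eq_tensor => -[k q]; rewrite /jw /= andbT.
case: (eqVneq k j) => [->|_] /=; last by rewrite !mulr1.
by rewrite ltnn mul1r if_same.
Qed.

Lemma vc_TmuE j u : vc_T R j * single ((j, mu) : Q) u = tensor (jw mu j u).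
Proof.
rewrite vc_TE singleE tensorM; apply: eq_tensor => -[k q]; rewrite /jw /= xpair_eqE.
case: (eqVneq k j) => [->|_] /=; last by rewrite !mulr1.
by rewrite ltnn -val_eqE /=; case: (ltngtP q 4) => //; rewrite ?mulr1 ?mul1r.
Qed.

Lemma vc_TnuE j u : vc_T R j * vcZ R j mu * single ((j, nu) : Q) u = tensor (jw nu j u).
Proof.
rewrite vc_TmuE singleE tensorM; apply: eq_tensor => -[k q]; rewrite /jw /= xpair_eqE.
case: (eqVneq k j) => [->|_] /=; last by rewrite !mulr1.
rewrite ltnn -!val_eqE /=; case: q => -[|[|[|[|[|[|q]]]]]] //= _; by rewrite ?mulr1 ?mul1r.
Qed.


Lemma jw_trmxC (m : 'I_6) j u q : (jw m j u q)^t* = jw m j (u^t*) q.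
Proof.
rewrite /jw; case: ifP => _; first exact: pauli_mx_trmxC.
case: ifP => _; last by rewrite trmx1 map_mx1.
case: ifP => _; first exact: pauli_mx_trmxC.
by case: ifP => // _; rewrite trmx1 map_mx1.
Qed.

End Hop.

(* Letters at the two ends of the Pauli strings in the encoding of the hopping
   term of the species s along d = 0, 1, 2; the two strings are told apart by w. *)
Definition first_letter (d s : nat) (w : bool) (q : nat) : pauli :=
  if q == s then (if w then PY else PX) else
  if d == 0%N then (if (s < q)%N then PZ else PI) else
  if q == (3 + d)%N then PX else if (s < q < 3 + d)%N then PZ else PI.

Definition second_letter (d s : nat) (w : bool) (q : nat) : pauli :=
  if q == s then (if w (+) (d != 0%N) then PY else PX) else
  if d == 0%N then (if (q < s)%N then PZ else PI) else
  if q == (3 + d)%N then PY else if (s < q < 3 + d)%N then PZ else PI.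

(** Up to the other letters, the hopping term is (XX + YY) / 2 along x, while the auxiliary pair
    makes it (YX - XY) / 2 along y and z. [w] marks the string with Y at its first end. *)
Definition hop_coef (R : realType) (d : nat) (w : bool) : R :=
  if (d == 0%N) || w then 2^-1 else - 2^-1.

Section HopStrings.
Variables (R : realType) (L : nat).
Local Notation C := (Cplx R).
Local Notation Q := (site L * 'I_6)%type.
Local Notation Z := (pauli_mx R PZ).
Local Notation X := (pauli_mx R PX).
Local Notation Y := (pauli_mx R PY).
Local Notation lower := (lower R).

Lemma mulZZ : Z * Z = 1.
Proof. by rewrite mx2M mx2_1; congr mx2; ring. Qed.

Lemma mulZX : Z * X = - (X * Z).
Proof. by rewrite -scaleN1r !mx2M mx2Z; congr mx2; ring. Qed.

Lemma lowerC : lower^t* = mx2 0 0 1 0.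
Proof. by rewrite mx2_trmxC rmorph0 rmorph1. Qed.

Lemma mulZlower : Z * lower = lower.
Proof. by rewrite mx2M; congr mx2; ring. Qed.

Lemma mullowerZ : lower * Z = - lower.
Proof. by rewrite -scaleN1r mx2M mx2Z; congr mx2; ring. Qed.

Lemma mullowerCZ : lower^t* * Z = lower^t*.
Proof. by rewrite lowerC mx2M; congr mx2; ring. Qed.

Lemma hop_pair_plain (x x' y y' : 'I_2) :
  lower^t* x x' * lower y y' + lower x x' * lower^t* y y' =
  2^-1 * (X x x' * X y y') + 2^-1 * (Y x x' * Y y y').
Proof.
have i2 := sqrCi C; rewrite expr2 in i2.
rewrite lowerC !mxE.
case: (x == 0); case: (x' == 0); case: (y == 0); case: (y' == 0) => /=;
  rewrite ?mulrNN ?mulNr ?mulrN ?i2; by field.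
Qed.

(** The sign in [- lower] comes from the Z that the auxiliary string puts on the fermionic qubit of
    the later site, by [mullowerZ]. *)
Lemma hop_pair_aux (x x' y y' : 'I_2) :
  lower^t* x x' * (- lower) y y' + lower x x' * lower^t* y y' =
  (- 'i / 2) * (X x x' * Y y y') + ('i / 2) * (Y x x' * X y y').
Proof.
have i2 := sqrCi C; rewrite expr2 in i2.
rewrite lowerC !mxE.
case: (x == 0); case: (x' == 0); case: (y == 0); case: (y' == 0) => /=;
  rewrite ?(mul0r, mulr0, mul1r, mulr1, addr0, add0r, oppr0, mulrN, mulNr, opprK) //;
  rewrite ?[_ / 2 * 'i]mulrAC ?i2; by field.
Qed.

End HopStrings.

Section HopLayers.
Variables (R : realType) (L : nat).
Local Notation C := (Cplx R).
Local Notation Q := (site L * 'I_6)%type.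
Local Notation Z := (pauli_mx R PZ).
Local Notation X := (pauli_mx R PX).
Local Notation Y := (pauli_mx R PY).
Local Notation lower := (lower R).

Lemma jw_hop_trmxC s (i j : site L) : ((vc_a R s i)^t* * vc_a R s j)^t* =
  (vc_a R s j)^t* * vc_a R s i.
Proof. by rewrite -[in LHS]/(_ *m _) trmxC_mul trmxCK. Qed.

Section Plain.
Variables (s : 'I_4) (i j : site L).
Hypothesis ij : snake j = (snake i).+1.

Let r (q : Q) : 'M[C]_2 :=
  if q.1 == i then (if (s < q.2)%N then Z else 1) else
  if q.1 == j then (if (q.2 < s)%N then Z else 1) else 1.

(** The sites are consecutive, so the two tails differ exactly by the six Z of site [i]; on all
    earlier sites the Z square to 1. *)
Lemma jw_plain (a b : 'M[C]_2) (q : Q) :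
  jw (fermion s) i a q * jw (fermion s) j b q =
    (if q == (i, fermion s) then a * Z else if q == (j, fermion s) then b else r q) /\
  jw (fermion s) j b q * jw (fermion s) i a q =
    (if q == (i, fermion s) then Z * a else if q == (j, fermion s) then b else r q).
Proof.
have ZZ := mulZZ R; have nij : i == j = false by apply/eqP => e; move: ij; rewrite e => /n_Sn.
case: q => k q; rewrite /jw /r /= !xpair_eqE -[q == _]val_eqE /= !ij.
case: (eqVneq k i) => [->|ki] /=.
  rewrite ltnn ltnS leqnn nij.
  by case: (ltngtP q s) => _; rewrite ?ZZ ?mul1r ?mulr1.
case: (eqVneq k j) => [->|kj] /=.
  rewrite ij ltnn ltnNge leqnSn /=.
  by case: (ltngtP q s) => _; rewrite ?mul1r ?mulr1.
have -> : (snake k < (snake i).+1)%N = (snake k < snake i)%N.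
  rewrite ltnS leq_eqVlt; case: eqP => // /snake_inj e; by rewrite e eqxx in ki.
by case: ifP => _; rewrite ?ZZ ?mul1r ?mulr1.
Qed.

Lemma vc_jw_hop_plain : vc_jw_hop R s i j =
  (2^-1 : C) *: tensor_pair (i, fermion s) (j, fermion s) r X X +
  (2^-1 : C) *: tensor_pair (i, fermion s) (j, fermion s) r Y Y.
Proof.
rewrite /vc_jw_hop jw_hop_trmxC !vc_aE !tensor_trmxC !tensorM.
rewrite -(@tensor_pair_lin R _ _ _ r (lower^t*) lower lower (lower^t*)).
- congr (_ + _); apply: eq_tensor => q; rewrite jw_trmxC.
    by rewrite (jw_plain _ _ q).1 mullowerCZ.
  by rewrite (jw_plain _ _ q).2 mulZlower.
- by rewrite xpair_eqE negb_and; apply/orP; left; apply/eqP => e; move: ij; rewrite e => /n_Sn.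
- exact: hop_pair_plain.
Qed.

End Plain.

Section Auxiliary.
Variables (m : 'I_6) (s : 'I_4) (i j : site L).
Hypotheses (m4 : (4 <= m)%N) (ij : (snake i < snake j)%N).

Let r (q : Q) : 'M[C]_2 :=
  if q.1 == i then (if q.2 == m then X else if (s < q.2 < m)%N then Z else 1) else
  if q.1 == j then (if q.2 == m then Y else if (s < q.2 < m)%N then Z else 1) else 1.

(** The only sign that arises: at the auxiliary qubit of the first site, Z X Z = - X. *)
Let c (q : Q) : C := if q == (i, m) then -1 else 1.

(** On a site between [i] and [j], the hopping product and the auxiliary product each put one Z on
    every qubit, and these cancel. Hence [i] and [j] may be far apart on the path. *)
Lemma jw_aux (a b : 'M[C]_2) (q : Q) :
  let K := jw m i X q * jw m j Y q in
  jw (fermion s) i a q * jw (fermion s) j b q * K =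
    c q *: (if q == (i, fermion s) then a * Z else if q == (j, fermion s) then b * Z else r q) /\
  jw (fermion s) j b q * jw (fermion s) i a q * K =
    c q *: (if q == (i, fermion s) then Z * a else if q == (j, fermion s) then b * Z else r q).
Proof.
have ZZ := mulZZ R; have ZX := mulZX R.
have nij : i == j = false by apply/eqP => e; move: ij; rewrite e ltnn.
have sm : (s < m)%N by apply: leq_trans m4; exact: ltn_ord.
have nms : m == s :> nat = false by apply: gtn_eqF.
case: q => k q; rewrite /jw /r /c /= !xpair_eqE -![q == _]val_eqE /=.
case: (eqVneq k i) => [->|ki] /=.
  rewrite ij ltnn nij; case: (ltngtP q s) => qs.
  - rewrite (ltn_trans qs sm) (ltn_eqF (ltn_trans qs sm)) scale1r.
    by rewrite !ZZ ?mulr1.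
  - case: (ltngtP q m) => qm; rewrite ?mul1r ?mulr1 ?ZZ ?scale1r ?mulr1 //.
    by rewrite mulrA ZX mulNr -mulrA ZZ mulr1 scaleN1r.
  - by rewrite qs sm (ltn_eqF sm) !scale1r ZZ !mulr1.
case: (eqVneq k j) => [->|kj] /=.
  rewrite ltnNge (ltnW ij) ltnn /= scale1r !mul1r !mulr1; case: (ltngtP q s) => qs.
  - rewrite (ltn_trans qs sm) (ltn_eqF (ltn_trans qs sm)).
    by rewrite !ZZ.
  - by case: (ltngtP q m) => qm; rewrite ?mul1r ?mulr1.
  - by rewrite qs sm.
rewrite scale1r.
by case: ifP => _; case: ifP => _; rewrite ?mul1r ?mulr1 ?ZZ ?mulr1 ?mul1r ?ZZ.
Qed.

Lemma vc_jw_hop_aux :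
  vc_jw_hop R s i j * ('i *: (tensor (jw m i X) * tensor (jw m j Y))) =
  (- 2^-1 : C) *: tensor_pair (i, fermion s) (j, fermion s) r X Y +
  (2^-1 : C) *: tensor_pair (i, fermion s) (j, fermion s) r Y X.
Proof.
rewrite /vc_jw_hop jw_hop_trmxC !vc_aE !tensor_trmxC !tensorM mul_opZr mulrDl !tensorM.
have prodc : \prod_q c q = -1.
  by rewrite /c -big_mkcond big_pred1_eq.
have -> : tensor (fun q => (jw (fermion s) i lower q)^t* * jw (fermion s) j lower q *
     (jw m i X q * jw m j Y q)) =
     -1 *: tensor_pair (i, fermion s) (j, fermion s) r (lower^t*) (- lower).
  rewrite -prodc -tensorZ; apply: eq_tensor => q.
  by rewrite jw_trmxC (jw_aux _ _ q).1 mullowerCZ mullowerZ.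
have -> : tensor (fun q => (jw (fermion s) j lower q)^t* * jw (fermion s) i lower q *
     (jw m i X q * jw m j Y q)) =
     -1 *: tensor_pair (i, fermion s) (j, fermion s) r lower (lower^t*).
  rewrite -prodc -tensorZ; apply: eq_tensor => q.
  by rewrite jw_trmxC (jw_aux _ _ q).2 mulZlower mullowerCZ.
rewrite -scalerDr (tensor_pair_lin _ _ (@hop_pair_aux R)); last first.
  by rewrite xpair_eqE negb_and; apply/orP; left; apply/eqP => e; move: ij; rewrite e ltnn.
have i2 := sqrCi C; rewrite expr2 in i2.
(* The factor ['i] comes from the encoding of the bond, -1 from [c], and the last factor from
   [hop_pair_aux]. *)
have c1 : 'i * -1 * (- 'i / 2) = - 2^-1 :> C.
  by rewrite mulrN1 mulrA mulrNN i2 mulN1r.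
have c2 : 'i * -1 * ('i / 2) = 2^-1 :> C.
  by rewrite mulrN1 mulrA mulNr i2 opprK mul1r.
by rewrite scalerA scalerDr !scalerA c1 c2.
Qed.

End Auxiliary.

Lemma vc_hop_strings (d : 'I_3) (s : 'I_4) (i j : site L) : bond d i j ->
  vc_hop R d s i j = \sum_(w : bool) ((hop_coef R d w)%:C%C : C) *:
    pstring R fst snd (first_letter d s w) (second_letter d s w) (i, j).
Proof.
move=> b; have ij : (snake i < snake j)%N by case/andP: b.
have nij : i == j = false by apply/eqP => e; move: ij; rewrite e ltnn.
have half : (2^-1 : R)%:C%C = 2^-1 :> C by rewrite fmorphV rmorph_nat.
rewrite big_bool /= addrC.
have auxE (m : 'I_6) w : (m = 3 + d :> nat)%N -> d != 0 :> nat -> (4 <= m)%N ->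
  pstring R fst snd (first_letter d s w) (second_letter d s w) (i, j) =
  tensor_pair (i, fermion s) (j, fermion s) (fun q : Q =>
    if q.1 == i then (if q.2 == m then X else if (s < q.2 < m)%N then Z else 1) else
    if q.1 == j then (if q.2 == m then Y else if (s < q.2 < m)%N then Z else 1) else 1)
   (if w then Y else X) (if w then X else Y).
  move=> md d0 m4; apply: eq_tensor => -[k q] /=.
  rewrite /first_letter /second_letter !xpair_eqE -![q == _]val_eqE /= -md (negPf d0).
  case: (eqVneq k i) => [->|ki] /=; first (rewrite nij; case: w; do 3![case: ifP => // _]).
  case: (eqVneq k j) => _ //=; by case: w; do 3![case: ifP => // _].
have plainE w : d = 0%N :> nat ->
  pstring R fst snd (first_letter d s w) (second_letter d s w) (i, j) =
  tensor_pair (i, fermion s) (j, fermion s) (fun q : Q =>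
    if q.1 == i then (if (s < q.2)%N then Z else 1) else
    if q.1 == j then (if (q.2 < s)%N then Z else 1) else 1)
   (if w then Y else X) (if w then Y else X).
  move=> d0; apply: eq_tensor => -[k q] /=.
  rewrite /first_letter /second_letter !xpair_eqE -![q == _]val_eqE /= d0.
  case: (eqVneq k i) => [->|ki] /=; first (rewrite nij; case: w; do 2![case: ifP => // _]).
  by case: (eqVneq k j) => _ //=; case: w; do 2![case: ifP => // _].
have coefE w : ((hop_coef R d w)%:C%C : C) =
    if (d == 0%N :> nat) || w then 2^-1 else - 2^-1.
  by rewrite /hop_coef; case: ifP => _; rewrite ?rmorphN /= half.
rewrite !coefE orbT.
have [dE|[dE|dE]] : d = ax_x \/ d = ax_y \/ d = ax_z.
- by case: d {b auxE plainE coefE} => -[|[|[|d]]] // hd;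
    [left|right; left|right; right]; apply: val_inj.
- by subst d; rewrite !plainE // /vc_hop (vc_jw_hop_plain s (bond_x b)).
- by subst d; rewrite !(auxE mu) // /vc_hop /vc_mu /vc_mubar !vc_TmuE vc_jw_hop_aux.
- by subst d; rewrite !(auxE nu) // /vc_hop /vc_nu /vc_nubar !vc_TnuE vc_jw_hop_aux.
Qed.

End HopLayers.

(** * Depth of the Trotter step *)

Definition string_qubits (d s : nat) (w : bool) : pred nat :=
  fun q => (q != s) && (nontrivial (first_letter d s w q) || nontrivial (second_letter d s w q)).

Definition string_cost (d s : nat) (w : bool) : nat :=
  (count (string_qubits d s w) (iota 0 6)).+1.*2.

(** A finite check, decided by computation. It makes the splitting of a hopping layer into its eight
    string sums exact, without Trotter error. *)
Lemma letters_commute (d : 'I_3) (s s' : 'I_4) (w w' : bool) :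
  ~~ (\big[addb/false]_(q < 6) anticommute (first_letter d s w q) (first_letter d s' w' q) (+)
      \big[addb/false]_(q < 6) anticommute (second_letter d s w q) (second_letter d s' w' q)).
Proof.
have sumE (F : nat -> bool) : \big[addb/false]_(q < 6) F q =
    foldr addb false [seq F q | q <- iota 0 6].
  by rewrite -(big_mkord predT) foldrE big_map.
rewrite (sumE (fun q => anticommute (first_letter d s w q) (first_letter d s' w' q))).
rewrite (sumE (fun q => anticommute (second_letter d s w q) (second_letter d s' w' q))).
case: d => -[|[|[|d]]] // hd; case: s => -[|[|[|[|s]]]] // hs;
  case: s' => -[|[|[|[|s']]]] // hs'; case: w; case: w'; exact: isT.
Qed.

Section Costs.
Variables (R : realType) (L : nat).
Local Notation C := (Cplx R).
Local Notation Q := (site L * 'I_6)%type.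
Variables (f0 : nat) (P : Op R Q -> nat -> Prop).
Hypothesis PM : cost_model f0 P.

Lemma expmx_mi_phase (phi : basis Q -> R) :
  expmx_mi (diagop (fun b => (phi b)%:C%C)) = phase (fun b => - phi b).
Proof.
have U1 : (1 : Op R Q) \is unitarymx by apply/unitarymxP; rewrite -[LHS]/(1 *m _) mul1mx trmx1 map_mx1.
have := exp_conj_diagop phi U1.
have -> : (1 : Op R Q)^t* = 1 by rewrite trmx1 map_mx1.
by rewrite !mulr1 !mul1r.
Qed.

Lemma expmx_mi0 : expmx_mi (0 : Op R Q) = 1.
Proof.
have := expmx_mi_phase (fun=> 0).
(* Writing 0 as [0 * 0] exposes a scalar factor that folds the diagonal operator into the zero
   matrix. *)
rewrite (eq_diagop (psi := fun=> 0 * 0)) => [|b]; last by rewrite mul0r rmorph0.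
rewrite -diagopZ scale0r => ->; rewrite -diagop1.
by apply: eq_diagop => b; rewrite oppr0 expi0.
Qed.

Lemma cost_expmx_sum (I : Type) (r : seq I) (A : I -> Op R Q) (n : I -> nat) :
  (forall k, (A k)^t* = A k) -> (forall k k', A k * A k' = A k' * A k) ->
  (forall k, P (expmx_mi (A k)) (n k)) ->
  P (expmx_mi (\sum_(k <- r) A k)) (\sum_(k <- r) n k)%N.
Proof.
move=> hA cA PA; elim: r => [|k r IH].
  by rewrite !big_nil expmx_mi0; exact: (cost1 PM).
rewrite !big_cons expmx_miD //; first exact: (costM PM).
- apply: entryP => a b; rewrite entry_trmxC !entry_sum rmorph_sum.
  by apply: eq_bigr => j _; rewrite /= -entry_trmxC hA.
- rewrite -[LHS]/(_ * _) -[RHS]/(_ * _) mulr_sumr mulr_suml.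
  by apply: eq_bigr => j _; exact: cA.
Qed.

Lemma real_opA (x y : R) (A : Op R Q) : real_op x (real_op y A) = real_op (x * y) A.
Proof. by rewrite /real_op scalerA rmorphM. Qed.

Lemma cost_hop_layer (h t : R) (d : 'I_3) (p : bool) :
  P (expmx_mi (real_op t (vc_hop_layer L h d p)))
    (\sum_(s < 4) \sum_(w : bool) (f0 + string_cost d s w))%N.
Proof.
pose D := layer_bonds d p : {pred site L * site L}.
pose A (k : 'I_4 * bool) : Op R Q := ((t * - h * hop_coef R d k.2)%:C%C : C) *:
  string_sum R D fst snd (first_letter d k.1 k.2) (second_letter d k.1 k.2).
have -> : real_op t (vc_hop_layer L h d p) = \sum_k A k.
  rewrite /vc_hop_layer real_opA /real_op exchange_big /= -(pair_bigA _ (fun s w => A (s, w))) /=.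
  rewrite scaler_sumr; apply: eq_bigr => s _.
  rewrite (eq_bigr (fun b => \sum_(w : bool) ((hop_coef R d w)%:C%C : C) *:
    pstring R fst snd (first_letter d s w) (second_letter d s w) b)); last first.
    by move=> [i j] /andP[b _]; rewrite vc_hop_strings.
  rewrite exchange_big /= scaler_sumr; apply: eq_bigr => w _.
  by rewrite -scaler_sumr scalerA -rmorphM.
rewrite pair_bigA /=.
apply: cost_expmx_sum => [k|k k'|[s w]].
- apply: entryP => a b; rewrite entry_trmxC !entryZ rmorphM /= conj_real_complex.
  by rewrite -entry_trmxC string_sum_trmxC.
- rewrite /A !mul_opZl !mul_opZr !scalerA mulrC; congr (_ *: _).
  apply: string_sum_comm.
  + exact: layer_bonds_fst_inj.
  + exact: layer_bonds_snd_inj.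
  + exact: layer_bonds_disjoint.
  + exact: letters_commute.
(* One list for both ends: a qubit used at either end gets a layer, so the parities at the two ends
   are gathered simultaneously. *)
pose r := [seq q : 'I_6 <- enum 'I_6 | string_qubits d s w q].
have sizer : size r = count (string_qubits d s w) (iota 0 6).
  by rewrite size_filter -val_enum_ord count_map.
rewrite /string_cost -sizer /A /=.
(* [E1] is the set of first ends of the layer; disjointness of the bonds keeps the second ends out
   of it. *)
apply: (@cost_string_sum R (site L) _ D fst snd _ _ _ [pred i | [exists j, (i, j) \in D]]
  _ _ _ _ (fermion s)).
- exact: layer_bonds_fst_inj.
- exact: layer_bonds_snd_inj.
- exact: layer_bonds_disjoint.
- by move=> [i j] ij; apply/existsP; exists j.
- move=> [i j] ij; apply/existsP => -[j' jj'].
  by have := layer_bonds_disjoint jj' ij; rewrite /= eqxx.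
- by rewrite /first_letter eqxx; case: (w).
- by rewrite /second_letter eqxx; case: ifP.
- by rewrite mem_filter /string_qubits eqxx.
- by rewrite filter_uniq // enum_uniq.
- move=> q qs nt; rewrite mem_filter mem_enum andbT; apply/andP; split; [exact: qs | exact: nt].
- exact: PM.
Qed.

End Costs.

(** * The on-site terms as parities of bits *)

Section Onsite.
Variables (R : realType) (L : nat).
Local Notation C := (Cplx R).
Local Notation Q := (site L * 'I_6)%type.

Definition onsite_energy (h cC dD : R) (n : 'I_4 -> bool) : R :=
  6 * h * (\sum_s (n s)%:R)
  + cC / 2 * (\sum_s \sum_(s' | s' != s) (n s)%:R * (n s')%:R)
  + dD / 6 * (\sum_s \sum_(s' | s' != s) \sum_(s'' | (s'' != s) && (s'' != s'))
       (n s)%:R * (n s')%:R * (n s'')%:R).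

Lemma vc_NE s x : vc_N R s x = diagop (fun b : basis Q => (b (x, fermion s))%:R).
Proof.
rewrite /vc_N /vcZ /pZ (_ : single _ _ =
   diagop (fun b : basis Q => (-1) ^+ b (x, fermion s))); last first.
  pose f (q : Q) (y : bool) : C := if q == (x, fermion s) then (-1) ^+ y else 1.
  rewrite (eq_diagop (psi := fun b => \prod_q f q (b q))) => [|b].
    rewrite -(tensor_diag2 f); apply: eq_tensor => q; rewrite /f.
    by case: eqP => //= _; rewrite /diag2 -mx2_1.
  by rewrite /f -big_mkcond big_pred1_eq.
rewrite -diagop1 -scaleN1r diagopZ diagopD diagopZ; apply: eq_diagop => b.
by case: (b _); rewrite /=; by field.
Qed.

Lemma vc_onsiteE (h cC dD : R) : vc_onsite L h cC dD =
  diagop (fun b : basis Q =>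
    (\sum_x onsite_energy h cC dD (fun s => b (x, fermion s)))%:C%C).
Proof.
have e1 x : \sum_(s : 'I_4) vc_N R s x =
    diagop (fun b : basis Q => \sum_s (b (x, fermion s))%:R).
  by rewrite -diagop_sum; apply: eq_bigr => s _; rewrite vc_NE.
have e2 x : \sum_(s : 'I_4) \sum_(s' : 'I_4 | s' != s) vc_N R s x * vc_N R s' x =
    diagop (fun b : basis Q => \sum_s \sum_(s' | s' != s)
      (b (x, fermion s))%:R * (b (x, fermion s'))%:R).
  rewrite -diagop_sum; apply: eq_bigr => s _; rewrite -diagop_sum; apply: eq_bigr => s' _.
  by rewrite !vc_NE diagopM.
have e3 x : \sum_(s : 'I_4) \sum_(s' : 'I_4 | s' != s)
      \sum_(s'' : 'I_4 | (s'' != s) && (s'' != s')) vc_N R s x * vc_N R s' x * vc_N R s'' x =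
    diagop (fun b : basis Q => \sum_s \sum_(s' | s' != s)
      \sum_(s'' | (s'' != s) && (s'' != s'))
      (b (x, fermion s))%:R * (b (x, fermion s'))%:R * (b (x, fermion s''))%:R).
  rewrite -diagop_sum; apply: eq_bigr => s _; rewrite -diagop_sum; apply: eq_bigr => s' _.
  rewrite -diagop_sum; apply: eq_bigr => s'' _.
  by rewrite !vc_NE !diagopM.
rewrite /vc_onsite /real_op (eq_bigr _ (fun x _ => e1 x)) (eq_bigr _ (fun x _ => e2 x))
  (eq_bigr _ (fun x _ => e3 x)) !diagop_sum !diagopZ !diagopD.
apply: eq_diagop => b; rewrite !mulr_sumr -!big_split /= rmorph_sum.
apply: eq_bigr => x _; rewrite /onsite_energy !(rmorphD, rmorphM, rmorph_sum) /=.
congr (_ * _ + _ * _ + _ * _).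
- by apply: eq_bigr => s _; rewrite rmorph_nat.
- apply: eq_bigr => s _; rewrite rmorph_sum; apply: eq_bigr => s' _.
  by rewrite rmorphM /= !rmorph_nat.
- apply: eq_bigr => s _; rewrite rmorph_sum; apply: eq_bigr => s' _.
  rewrite rmorph_sum; apply: eq_bigr => s'' _.
  by rewrite !rmorphM /= !rmorph_nat.
Qed.

Let i0 : 'I_4 := @Ordinal 4 0 isT.
Let i1 : 'I_4 := @Ordinal 4 1 isT.
Let i2 : 'I_4 := @Ordinal 4 2 isT.
Let i3 : 'I_4 := @Ordinal 4 3 isT.

(* Nonempty sets of at most three species, as a first element and the others. *)
Definition species_sets : seq ('I_4 * seq 'I_4) :=
  [:: (i0, [::]); (i1, [::]); (i2, [::]); (i3, [::]);
      (i0, [:: i1]); (i0, [:: i2]); (i0, [:: i3]);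
      (i1, [:: i2]); (i1, [:: i3]); (i2, [:: i3]);
      (i0, [:: i1; i2]); (i0, [:: i1; i3]); (i0, [:: i2; i3]); (i1, [:: i2; i3])].

(** Summing over ordered tuples cancels the factors 1/2 and 1/6. A pair xy contributes 1/2 to each
    bit and -1/2 to its parity; a triple contributes 1/4 to each bit, -1/4 to each pair parity and
    1/4 to the triple parity. A species lies in three pairs and three triples, a pair in two
    triples. *)
Definition parity_coef (h cC dD : R) (k : nat) : R := match k with
  | 0 => 6 * h + 3 / 2 * cC + 3 / 4 * dD | 1 => - cC / 2 - dD / 2 | _ => dD / 4 end.

Lemma sum_ord4 (F : 'I_4 -> R) : \sum_i F i = F i0 + F i1 + F i2 + F i3.
Proof.
rewrite !big_ord_recl big_ord0 addr0 !addrA.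
by congr (_ + _ + _ + _); congr F; apply: val_inj.
Qed.

(* Products of bits are combinations of parities: 2xy = x + y - (x + y mod 2),
   and likewise for three bits. *)
Lemma onsite_energy_parity (h cC dD : R) (n : 'I_4 -> bool) :
  onsite_energy h cC dD n = \sum_(e <- species_sets) parity_coef h cC dD (size e.2) *
    (n e.1 (+) foldr addb false [seq n s | s <- e.2])%:R.
Proof.
rewrite /onsite_energy.
under [X in _ + cC / 2 * X]eq_bigr do rewrite big_mkcond sum_ord4.
under [X in _ + dD / 6 * X]eq_bigr => s _.
  rewrite big_mkcond /=.
  under eq_bigr do rewrite big_mkcond sum_ord4.
  rewrite sum_ord4.
over.
rewrite !sum_ord4 /species_sets !big_cons big_nil /=.
case: (n i0); case: (n i1); case: (n i2); case: (n i3); rewrite /=; by field.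
Qed.

End Onsite.

Section TrotterCost.
Variables (R : realType) (L : nat).
Local Notation C := (Cplx R).
Local Notation Q := (site L * 'I_6)%type.
Variables (f0 : nat) (P : Op R Q -> nat -> Prop).
Hypothesis PM : cost_model f0 P.

Lemma cost_phase_sum (I : eqType) (r : seq I) (phi : I -> basis Q -> R) (n : I -> nat) :
  {in r, forall k, P (phase (phi k)) (n k)} ->
  P (phase (fun b => \sum_(k <- r) phi k b)) (\sum_(k <- r) n k)%N.
Proof.
elim: r => [|k r IH] Pr.
  rewrite big_nil [phase _](_ : _ = 1); first exact: (cost1 PM).
  by rewrite -diagop1; apply: eq_diagop => b; rewrite big_nil expi0.
rewrite big_cons (eq_phase (psi := fun b => phi k b + \sum_(j <- r) phi j b)) => [|b].
  rewrite phaseD; apply: (costM PM); first by apply: Pr; rewrite mem_head.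
  by apply: IH => j jr; apply: Pr; rewrite inE jr orbT.
by rewrite big_cons.
Qed.

Lemma cost_onsite (h cC dD t : R) :
  P (expmx_mi (real_op t (vc_onsite L h cC dD)))
    (\sum_(e <- species_sets) (f0 + (size e.2).*2))%N.
Proof.
pose c (e : 'I_4 * seq 'I_4) := - t * parity_coef h cC dD (size e.2).
rewrite vc_onsiteE /real_op diagopZ.
rewrite (eq_diagop (psi := fun b : basis Q =>
    (t * \sum_x onsite_energy h cC dD (fun s => b (x, fermion s)))%:C%C)) => [|b]; last by rewrite rmorphM.
rewrite expmx_mi_phase (eq_phase (psi := fun b : basis Q => \sum_(e <- species_sets)
    \sum_x c e * (site_parity (fermion e.1) (fun _ _ => true) (map fermion e.2) b x)%:R)) => [|b].
  apply: cost_phase_sum => e eS; rewrite -[size e.2](size_map fermion).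
  apply: (@cost_site_parity R (site L) f0 P PM _ _ (fun y => \sum_x c e * (y x)%:R) _ _).
    rewrite mem_map; last by move=> x y /(congr1 val) /= xy; apply: val_inj.
    by move: e eS; apply/allP.
  exact: (cost_base PM (fermion e.1) (fun _ y => c e * y%:R)).
rewrite -mulNr mulr_sumr exchange_big /=; apply: eq_bigr => x _.
rewrite onsite_energy_parity mulr_sumr; apply: eq_bigr => e _.
rewrite mulrA; congr (_ * _%:R); congr nat_of_bool; rewrite /site_parity; congr (_ (+) _).
by rewrite foldrE !big_map.
Qed.

Definition layer_cost (g : layer_index) : nat :=
  (if g is Some (d, p) then \sum_(s < 4) \sum_(w : bool) (f0 + string_cost d s w)
   else \sum_(e <- species_sets) (f0 + (size e.2).*2))%N.

Lemma cost_trotter1 (h cC dD t : R) (order : seq layer_index) :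
  P (trotter1 L h cC dD order t) (\sum_(g <- order) layer_cost g)%N.
Proof.
rewrite /trotter1; elim: order => [|g order IH].
  by rewrite !big_nil; exact: (cost1 PM).
rewrite !big_cons; apply: (costM PM) => //.
by case: g => [[d p]|]; [exact: cost_hop_layer | exact: cost_onsite].
Qed.

(** Apart from [f0], a hopping layer costs 96 along x, 56 along y and 72 along z, and there are two
    of each. The on-site layer costs 28: two for each of six pairs and four for each of four
    triples. There are eight phases in each of the six hopping layers and 14 in the on-site layer,
    62 in all. *)
Lemma total_layer_cost (order : seq layer_index) :
  perm_eq order (enum (layer_index : finType)) ->
  (\sum_(g <- order) layer_cost g = 476 + 62 * f0)%N.
Proof.
move=> perm; rewrite (perm_big _ perm) /= big_enum /= (bigD1 None) //=.
rewrite (reindex_omap Some id) /=; last by case.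
rewrite [X in (_ + X)%N = _](eq_bigl predT); last by move=> x; rewrite eqxx.
rewrite (eq_bigr (fun dp : 'I_3 * bool =>
   \sum_(s < 4) \sum_(w : bool) (f0 + string_cost dp.1 s w)))%N; last by case.
rewrite -(pair_bigA _ (fun (d : 'I_3) (p : bool) =>
   \sum_(s < 4) \sum_(w : bool) (f0 + string_cost d s w)))%N /=.
rewrite !big_cons big_nil !big_ord_recl !big_ord0 !big_bool.
rewrite /string_cost /=; lia.
Qed.

End TrotterCost.

Theorem lemma10 (R : realType) (L : nat) (hL : (0 < L)%N) (h cC dD t : R)
    (order : seq layer_index)
    (horder : perm_eq order (enum (layer_index : finType))) :
  implemented_with_depth (trotter1 L h cC dD order t) 520 /\
  controlled_implemented_with_depth (site L) (trotter1 L h cC dD order t) 630.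
Proof.
split.
  have PM := implemented_cost_model R (site L).
  apply: (cost_le PM) (cost_trotter1 PM h cC dD t order).
  by rewrite total_layer_cost.
have PM := controlled_cost_model R (site L).
have : cimplemented (site L) 1 (trotter1 L h cC dD order t) 630.
  apply: (cost_le PM) (cost_trotter1 PM h cC dD t order).
  by rewrite total_layer_cost.
by rewrite /controlled_implemented_with_depth controlled_block.
Qed.
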